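(* Let $1<p<\infty$ and let $V$ be a positive operator on $L^p[0,1]$. If the set of positive operators $T$ on $L^p[0,1]$ satisfying $V\in\mathcal{L}_T$ is dense in one of the spaces $(\mathcal{C}_p,\mathrm{WOT})$, $(\mathcal{I}_p,\mathrm{SOT})$, $(\mathcal{U}_p,\mathrm{SOT})$ (that is, the set of those elements $T$ of the respective space with $V\in\mathcal{L}_T$ is dense in it), then $V=\lambda I$ for some $\lambda\in[0,1]$.
   Context: $L^p[0,1]$ is the complex $L^p$-space of Lebesgue measure. An operator $T$ on it is positive if $Tf\ge0$ whenever $f\ge 0$. $\mathcal{C}_p$, $\mathcal{I}_p$, $\mathcal{U}_p$ denote the sets of positive contractions, positive (linear) isometries, and positive invertible (surjective) isometries of $L^p[0,1]$. WOT and SOT are the weak and strong operator topologies. The weak limit semigroup $\mathcal{L}_T$ is the set of operators $S$ such that $T^{n_k}\to S$ in the weak operator topology for some strictly increasing sequence $(n_k)$ in $\mathbb{N}$. *)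

(* Defs.v *)
From HB Require Import structures.
From mathcomp Require Import all_boot all_order all_algebra.
From mathcomp Require Import generic_quotient ring_quotient.
From mathcomp Require Import complex.
From mathcomp Require Import all_classical all_reals all_analysis.
From mathcomp Require Import measurable_realfun.

Set Implicit Arguments.
Unset Strict Implicit.
Unset Printing Implicit Defensive.

Import Order.TTheory GRing.Theory Num.Theory.
Import numFieldNormedType.Exports.
Import Normc.

Local Open Scope classical_set_scope.
Local Open Scope ring_scope.
Local Open Scope complex_scope.
Local Open Scope quotient_scope.

Section complex_functions.
Context d (T : measurableType d) (R : realType).
Implicit Types f g : T -> R[i].

Definition modulus f (x : T) : R := normc (f x).

Definition cmeasurable f : Prop :=
  measurable_fun setT (fun x => complex.Re (f x)) /\
  measurable_fun setT (fun x => complex.Im (f x)).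

Lemma modulus_ge0 f x : 0 <= modulus f x.
Proof. by rewrite /modulus; case: (f x) => a b /=; exact: sqrtr_ge0. Qed.

Lemma modulusD f g x : modulus (f + g) x <= modulus f x + modulus g x.
Proof. exact: le_normcD. Qed.

Lemma modulusZ (a : R[i]) f : modulus (a *: f) = normc a \*: modulus f.
Proof. by apply/funext => x; rewrite /modulus /= normcM. Qed.

Lemma measurable_modulus f : cmeasurable f -> measurable_fun setT (modulus f).
Proof.
move=> [mRe mIm].
have -> : modulus f = (fun x => Num.sqrt
    (complex.Re (f x) ^+ 2 + complex.Im (f x) ^+ 2)).
  by apply/funext => x; rewrite /modulus; case: (f x).
have msqrt : measurable_fun [set: R] (@Num.sqrt R).
  apply: continuous_measurable_fun; exact: sqrt_continuous.
apply: (measurableT_comp msqrt).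
by apply: measurable_funD; exact: (measurable_funX 2).
Qed.

Lemma cmeasurable0 : cmeasurable 0.
Proof. by split; exact: measurable_cst. Qed.

Lemma cmeasurableD f g : cmeasurable f -> cmeasurable g -> cmeasurable (f + g).
Proof.
move=> [fRe fIm] [gRe gIm]; split.
- rewrite (_ : (fun _ => _) =
      (fun x => complex.Re (f x)) \+ (fun x => complex.Re (g x))).
    exact: measurable_funD.
  by apply/funext => x; rewrite /= /GRing.add /=; case: (f x); case: (g x).
- rewrite (_ : (fun _ => _) =
      (fun x => complex.Im (f x)) \+ (fun x => complex.Im (g x))).
    exact: measurable_funD.
  by apply/funext => x; rewrite /= /GRing.add /=; case: (f x); case: (g x).
Qed.

Lemma cmeasurableZ (a : R[i]) f : cmeasurable f -> cmeasurable (a *: f).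
Proof.
move=> [fRe fIm]; case: a => a b; split.
- rewrite (_ : (fun _ => _) =
      (fun x => a * complex.Re (f x)) \- (fun x => b * complex.Im (f x))).
    by apply: measurable_funB; apply: measurable_funM.
  by apply/funext => x; rewrite /= -[(_ *: f) x]/(_ * f x); case: (f x).
- rewrite (_ : (fun _ => _) =
      (fun x => a * complex.Im (f x)) \+ (fun x => b * complex.Re (f x))).
    by apply: measurable_funD; apply: measurable_funM.
  by apply/funext => x; rewrite /= -[(_ *: f) x]/(_ * f x); case: (f x).
Qed.

End complex_functions.

Section complex_Lp.
Context d (T : measurableType d) (R : realType).
Variables (mu : {measure set T -> \bar R}) (p : R) (p1 : 1 <= p).
Implicit Types f g : T -> R[i].

Let p1E : (1 <= p%:E)%E. Proof. by rewrite lee_fin. Qed.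
Let p0 : 0 < p. Proof. exact: lt_le_trans p1. Qed.

Let measurable_abs_powR (w : T -> R) : measurable_fun setT w ->
  measurable_fun setT (fun x => (`|(EFin \o w) x| `^ p)%E).
Proof.
move=> mw; apply/measurable_EFinP.
apply: (@measurableT_comp _ _ _ _ _ _ (@powR R ^~ p)) => //.
exact: measurableT_comp.
Qed.

Lemma Lnorm_ler (u v : T -> R) : measurable_fun setT u -> measurable_fun setT v ->
  (forall x, 0 <= u x <= v x) ->
  ('N[mu]_p%:E[EFin \o u] <= 'N[mu]_p%:E[EFin \o v])%E.
Proof.
move=> mu_ mv uv.
rewrite unlock /=; apply: gt0_ler_poweR.
- by rewrite invr_ge0 ltW.
- by rewrite in_itv/= leey integral_ge0// => x _; rewrite poweR_ge0.
- by rewrite in_itv/= leey integral_ge0// => x _; rewrite poweR_ge0.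
apply: ge0_le_integral => //.
- exact: measurable_abs_powR.
- exact: measurable_abs_powR.
- move=> x _ /=; rewrite lee_fin.
  have /andP[u0 uvx] := uv x.
  have v0 := le_trans u0 uvx.
  by rewrite !ger0_norm//; apply: ge0_ler_powR; rewrite ?nnegrE// ltW.
Qed.

Lemma ae_eq_Lnorm (u v : T -> R) : measurable_fun setT u -> measurable_fun setT v ->
  {ae mu, forall x, u x = v x} ->
  ('N[mu]_p%:E[EFin \o u] = 'N[mu]_p%:E[EFin \o v])%E.
Proof.
move=> mu_ mv uv.
rewrite unlock /=; congr (_ `^ _)%E.
apply: ae_eq_integral => //; [exact: measurable_abs_powR|exact: measurable_abs_powR|].
by apply: filterS uv => x /= -> .
Qed.

Definition cLfun_pred : {pred T -> R[i]} :=
  mem [set f | cmeasurable f /\ finite_norm mu p%:E (modulus f)].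

Lemma cLfun_Lfun f : f \in cLfun_pred -> modulus f \in Lfun mu p%:E.
Proof.
by rewrite inE => -[mf nf]; rewrite !inE; apply/andP; split;
  rewrite inE//; exact: measurable_modulus.
Qed.

Lemma Lnorm_modulusZ (a : R[i]) f : f \in cLfun_pred ->
  ('N[mu]_p%:E[EFin \o modulus (a *: f)%R] =
   (normc a)%:E * 'N[mu]_p%:E[EFin \o modulus f])%E.
Proof.
move=> /cLfun_Lfun Lf.
rewrite modulusZ (LnormZ (Lfun_Sub p1E Lf)) ger0_norm//.
by case: a => a b /=; exact: sqrtr_ge0.
Qed.

Lemma Lnorm_modulusD f g : cmeasurable f -> cmeasurable g ->
  ('N[mu]_p%:E[EFin \o modulus (f + g)%R] <=
   'N[mu]_p%:E[EFin \o modulus f] + 'N[mu]_p%:E[EFin \o modulus g])%E.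
Proof.
move=> mf mg.
have mmf := measurable_modulus mf; have mmg := measurable_modulus mg.
apply: le_trans (eminkowski _ mmf mmg p1E).
apply: Lnorm_ler.
- exact/measurable_modulus/cmeasurableD.
- exact: measurable_funD.
- by move=> x; rewrite modulus_ge0 modulusD.
Qed.

Lemma cLfun_submod_closed : submod_closed cLfun_pred.
Proof.
split.
  rewrite inE; split; first exact: cmeasurable0.
  rewrite /finite_norm (_ : modulus 0 = cst 0); last first.
    by apply/funext => x; rewrite /modulus; exact: normc0.
  exact: finite_norm_cst0.
move=> a f g f_in g_in.
move: (f_in) (g_in); rewrite !inE => -[mf nf] [mg ng].
have maf := cmeasurableZ a mf.
split; first exact: cmeasurableD.
apply: le_lt_trans (Lnorm_modulusD maf mg) _.
rewrite lte_add_pinfty// Lnorm_modulusZ// lte_mul_pinfty// lee_fin.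
by case: a {maf} => a b /=; exact: sqrtr_ge0.
Qed.

HB.instance Definition _ := GRing.isSubmodClosed.Build _ _ cLfun_pred
  cLfun_submod_closed.

(* The phantom [q1] lets the instances below, which need 1 <= p, be inferred from
   the type. *)
Record cLfun (q1 : 1 <= p) := CLfun {
  cLfun_val :> T -> R[i]; cLfunP : cLfun_val \in cLfun_pred }.

Local Notation ty := (cLfun p1).
HB.instance Definition _ := [isSub for @cLfun_val p1].
HB.instance Definition _ := [Choice of ty by <:].
HB.instance Definition _ := [SubChoice_isSubLmodule of ty by <:].

Definition null_fun : {pred ty} :=
  [pred f : ty | `[< {ae mu, forall x, f x = 0} >]].

Lemma null_fun_zmod_closed : zmod_closed null_fun.
Proof.
split; first by apply/asboolP; exact: aeW.
move=> f g /asboolP f0 /asboolP g0; apply/asboolP.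
apply: filterS2 f0 g0 => x fx gx.
by rewrite -[(f - g) x]/(f x - g x) fx gx subrr.
Qed.

HB.instance Definition _ := GRing.isZmodClosed.Build _ null_fun
  null_fun_zmod_closed.

(* L^p(mu; C): p-integrable functions modulo those vanishing almost everywhere. *)
Definition cLp : Type := Quotient.quot null_fun.
HB.instance Definition _ := GRing.Zmodule.on cLp.
HB.instance Definition _ := EqQuotient.on cLp.

Lemma cLp_eqP (f g : ty) :
  \pi_cLp f = \pi_cLp g <-> {ae mu, forall x, f x = g x}.
Proof.
have -> : (\pi_cLp f = \pi_cLp g) <-> (f - g \in null_fun).
  by rewrite Quotient.idealrBE; split=> /eqP.
split=> [/asboolP|] fg; [|apply/asboolP]; apply: filterS fg => x.
  by rewrite -[(f - g) x]/(f x - g x) => /subr0_eq.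
by rewrite -[(f - g) x]/(f x - g x) => ->; rewrite subrr.
Qed.

Definition cLp_scale (a : R[i]) (u : cLp) : cLp := \pi_cLp (a *: repr u).

Lemma pi_scale a (f : ty) : cLp_scale a (\pi_cLp f) = \pi_cLp (a *: f).
Proof.
apply/cLp_eqP; have /cLp_eqP := reprK (\pi_cLp f).
by apply: filterS => x fx; exact: (congr1 ( *%R a) fx).
Qed.

Lemma cLp_ind (P : cLp -> Prop) : (forall f : ty, P (\pi_cLp f)) -> forall u, P u.
Proof. by move=> Pf u; rewrite -(reprK u). Qed.

Lemma pi_addr (f g : ty) : \pi_cLp (f + g) = \pi_cLp f + \pi_cLp g.
Proof. exact: (raddfD (\pi_cLp : {additive ty -> cLp})). Qed.

Lemma cLp_scalerA a b u : cLp_scale a (cLp_scale b u) = cLp_scale (a * b) u.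
Proof. by elim/cLp_ind: u => f; rewrite !pi_scale scalerA. Qed.

Lemma cLp_scale1r : left_id 1 cLp_scale.
Proof. by move=> u; elim/cLp_ind: u => f; rewrite pi_scale scale1r. Qed.

Lemma cLp_scalerDr : right_distributive cLp_scale +%R.
Proof.
move=> a u v; elim/cLp_ind: u => f; elim/cLp_ind: v => g.
by rewrite -pi_addr !pi_scale scalerDr pi_addr.
Qed.

Lemma cLp_scalerDl u : {morph cLp_scale^~ u : a b / a + b}.
Proof.
by move=> a b; elim/cLp_ind: u => f; rewrite !pi_scale scalerDl pi_addr.
Qed.

HB.instance Definition _ := GRing.Zmodule_isLmodule.Build R[i] cLp
  cLp_scalerA cLp_scale1r cLp_scalerDr cLp_scalerDl.

(* The scalars being R[i], a normed module takes its norm in R[i]; [pi_norm]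
   shows that the choice of representative is irrelevant. *)
Definition cLp_norm (u : cLp) : R[i] :=
  (fine ('N[mu]_p%:E[EFin \o modulus (repr u)])%E)%:C.

Lemma cLfun_fin_norm (f : ty) :
  (fine ('N[mu]_p%:E[EFin \o modulus f])%E)%:E = ('N[mu]_p%:E[EFin \o modulus f])%E.
Proof.
have := cLfunP f; rewrite inE => -[_ nf].
by rewrite fineK// fin_numElt (lt_le_trans ltNy0) ?Lnorm_ge0.
Qed.

Lemma cLfun_cmeasurable (f : ty) : cmeasurable f.
Proof. by have := cLfunP f; rewrite inE => -[]. Qed.

Lemma pi_norm (f : ty) :
  cLp_norm (\pi_cLp f) = (fine ('N[mu]_p%:E[EFin \o modulus f])%E)%:C.
Proof.
congr ((fine _)%:C); apply: ae_eq_Lnorm.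
- exact/measurable_modulus/cLfun_cmeasurable.
- exact/measurable_modulus/cLfun_cmeasurable.
- have /cLp_eqP := reprK (\pi_cLp f).
  by apply: filterS => x; rewrite /modulus => ->.
Qed.

Lemma cLp_ler_normD u v : cLp_norm (u + v) <= cLp_norm u + cLp_norm v.
Proof.
elim/cLp_ind: u => f; elim/cLp_ind: v => g.
rewrite -pi_addr !pi_norm -rmorphD lecR -lee_fin EFinD !cLfun_fin_norm.
by apply: Lnorm_modulusD; exact: cLfun_cmeasurable.
Qed.

Lemma cLp_normrZ a u : cLp_norm (a *: u) = `|a| * cLp_norm u.
Proof.
elim/cLp_ind: u => f; rewrite -[a *: _]/(cLp_scale a _) pi_scale !pi_norm.
rewrite -[`|a|]/(normc a)%:C -rmorphM; congr (_%:C).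
apply: EFin_inj; rewrite EFinM !cLfun_fin_norm.
exact/Lnorm_modulusZ/cLfunP.
Qed.

Lemma cLp_normr0_eq0 u : cLp_norm u = 0 -> u = 0.
Proof.
elim/cLp_ind: u => f; rewrite pi_norm => fn0.
have := congr1 (fun z => (complex.Re z)%:E) fn0; rewrite /=.
rewrite cLfun_fin_norm => f0.
have pi0 : \pi_cLp (0 : ty) = 0.
  exact: (raddf0 (\pi_cLp : {additive ty -> cLp})).
rewrite -pi0; apply/cLp_eqP.
have mf : measurable_fun setT (EFin \o modulus f).
  exact/measurable_EFinP/measurable_modulus/cLfun_cmeasurable.
have p0E : (0 < p%:E)%E by rewrite lte_fin.
have := Lnorm_eq0_eq0 mf p0E f0.
by apply: filterS => x /(_ Logic.I)[] /eq0_normc.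
Qed.

HB.instance Definition _ := Lmodule_isNormed.Build R[i] cLp
  cLp_ler_normD cLp_normrZ cLp_normr0_eq0.

(* In R[i], [0 <= z] means that z is real and nonnegative. *)
Definition cLp_ge0 (u : cLp) : Prop := {ae mu, forall x, 0 <= repr u x}.

Lemma pi_ge0 (f : ty) : cLp_ge0 (\pi_cLp f) <-> {ae mu, forall x, 0 <= f x}.
Proof.
have /cLp_eqP ef := reprK (\pi_cLp f).
by split; apply: filterS2 ef => x ->.
Qed.

End complex_Lp.

Section operators.
Context (K : numFieldType).

(* For a linear map between normed modules, continuous means bounded. *)
Record operator (E F : normedModType K) := Operator {
  operator_fun :> {linear E -> F};
  operator_continuous : continuous operator_fun }.

Context (E : normedModType K).
HB.instance Definition _ := gen_eqMixin (operator E E).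
HB.instance Definition _ := gen_choiceMixin (operator E E).

Definition op_id : operator E E :=
  @Operator E E (idfun : {linear E -> E}) (fun x => cvg_id).

Lemma op_comp_continuous (S T : operator E E) :
  continuous (S \o T : {linear E -> E}).
Proof.
move=> x; apply: continuous_comp; exact: operator_continuous.
Qed.

Definition op_comp (S T : operator E E) : operator E E :=
  Operator (op_comp_continuous (S := S) (T := T)).

Definition op_exp (T : operator E E) (n : nat) : operator E E :=
  iter n (op_comp T) op_id.

(* Coarsest topology making every [T |-> T u] continuous. *)
Definition sot : Type :=
  initial_topology (fun T : operator E E => (T : {ptws E -> E})).
HB.instance Definition _ := Topological.on sot.

(* Coarsest topology making every [T |-> phi (T u)] continuous, for phi in the
   dual [operator E K^o] of E. *)
Definition wot : Type :=
  initial_topology (fun T : operator E E =>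
    (fun uphi => uphi.2 (T uphi.1)) : {ptws (E * operator E K^o) -> K^o}).
HB.instance Definition _ := Topological.on wot.

Definition limit_semigroup (T : operator E E) : set (operator E E) :=
  [set S | exists n : nat -> nat, {homo n : i j / (i < j)%N} /\
    (fun k => op_exp T (n k) : wot) @ \oo --> (S : wot)].

End operators.

(* [t : A] is a point of A with the subspace topology induced by X. *)
Definition dense_in (X : topologicalType) (A D : set X) : Prop :=
  dense ([set t : A | D (\val t)]).

Section positive_operators.
Context d (T : measurableType d) (R : realType).
Variables (mu : {measure set T -> \bar R}) (p : R) (p1 : 1 <= p).
Local Notation Lp := (cLp mu p1).

Definition positive_operator (S : operator Lp Lp) : Prop :=
  forall u, cLp_ge0 u -> cLp_ge0 (S u).

Definition positive_contractions : set (operator Lp Lp) :=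
  [set S | positive_operator S /\ forall u, `|S u| <= `|u|].

Definition positive_isometries : set (operator Lp Lp) :=
  [set S | positive_operator S /\ forall u, `|S u| = `|u|].

Definition positive_invertible_isometries : set (operator Lp Lp) :=
  [set S | positive_isometries S /\ forall v, exists u, S u = v].

End positive_operators.

Arguments positive_contractions {d T R} mu {p} p1.
Arguments positive_isometries {d T R} mu {p} p1.
Arguments positive_invertible_isometries {d T R} mu {p} p1.

(* L^p[0,1] is realized by functions on R modulo equality almost everywhere on
   [0,1]. *)
Definition lebesgue01 (R : realType) :
    {measure set (measurableTypeR R) -> \bar R} :=
  mrestr lebesgue_measure (measurable_itv (`[0, 1]%R : interval R)).

Notation Lp01 hp := (cLp (lebesgue01 _) (ltW hp)).

(* Main.v *)
(* If T^(n_k) -> V weakly then V T = T V, because T commutes with its powers.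
   For fixed V the commutation relation is closed in T for both topologies, so
   density makes V commute with every positive invertible isometry. Among these
   are the swaps f |-> w^(1/p) (f o phi), where phi exchanges two adjacent
   intervals ]a, m] and ]m, b] of possibly different lengths by affine maps and
   w is its Jacobian. Commuting with the swaps inside an interval shows that V
   preserves the functions vanishing there. Commuting with the swap of ]0, c]
   and ]c, 1] then gives \int_]c, 1] V 1 = (1 - c) \int V 1, so V 1 is a constant
   lambda >= 0 and V 1_A = lambda 1_A first for intervals, then for Borel sets by
   Dynkin's lemma, and finally V = lambda I by density. Integrating
   T^(n_k) 1 -> lambda 1 gives lambda <= 1, since T is a contraction. *)
From HB Require Import structures.
From mathcomp Require Import all_boot all_order all_algebra.
From mathcomp Require Import generic_quotient complex ring lra.
From mathcomp Require Import all_classical all_reals all_analysis.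
From mathcomp Require Import measurable_realfun.
Require Import Defs.

Set Implicit Arguments.
Unset Strict Implicit.
Unset Printing Implicit Defensive.

Import Order.TTheory GRing.Theory Num.Theory.
Import numFieldNormedType.Exports.
Import Normc.

Local Open Scope classical_set_scope.
Local Open Scope ring_scope.
Local Open Scope complex_scope.
Local Open Scope quotient_scope.

(** * Change of variables under interval swaps *)

(** The invertible isometries form the smallest of the three classes, so each density hypothesis
    yields commutation with them and one argument serves all three cases. Multiplication of
    operators is not jointly continuous in the weak topology. Commutation still passes to the
    closure because [V] stays fixed: each side of phi (V (S u)) = phi (S (V u)) evaluates [S] at one
    vector and one functional.

    Intervals of unequal length are allowed so that a single swap reaches every cut point c. The
    swaps are affine, so the weight is constant on each of the two intervals, and a swap sends the
    indicator of one to a scalar multiple of the indicator of the other. Locality has to precede the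
    comparison of integrals: commutation relates V 1_]0, c] to V 1_]c, 1], and this says something
    about V 1 only once these two are known to be the restrictions of V 1. *)

Section affine.
Context (R : realType).
Local Notation leb := (@lebesgue_measure R).
Implicit Types (a b : R) (h : R -> \bar R).

Lemma measurable_affine a b : measurable_fun [set: R] (fun x : R => a * x + b).
Proof. by apply: measurable_funD => //; exact: measurable_funM. Qed.

Let aff a b (x : measurableTypeR R) : measurableTypeR R := a * x + b.
Let aff_push a b : {measure set (measurableTypeR R) -> \bar R} :=
  measure_function_pushforward__canonical__measure_function_Measure leb
    (measurable_affine a b : measurable_fun setT (aff a b)).

(** Both sides are measures in [A], and Lebesgue measure is determined by its values on half-open
    intervals. *)
Lemma lebesgue_measure_affine a b (A : set R) : 0 < a -> measurable A ->
  (leb A = a%:E * leb ((fun x => (a * x + b)%R) @^-1` A))%E.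
Proof.
move=> a0 mA; pose k : {nonneg R} := NngNum (ltW a0).
rewrite -[RHS]/(mscale k (aff_push a b) A).
apply: lebesgue_measure_unique => // X [[c d] _ <-].
rewrite -[RHS]/(a%:E * leb ((fun x => (a * x + b)%R) @^-1` `]c, d]))%E.
rewrite (_ : _ @^-1` _ = `](c - b) / a, (d - b) / a]%classic); last first.
  apply/seteqP; split => x /=; rewrite !in_itv/= ltr_pdivrMr// ler_pdivlMr//;
    by rewrite ltrBlDr lerBrDr mulrC.
rewrite !lebesgue_measure_itv/= !lte_fin ltr_pM2r ?invr_gt0// ltrD2r.
case: ifPn => _; last by rewrite mule0.
rewrite -!EFinD -EFinM; congr EFin; field; exact: lt0r_neq0.
Qed.

Lemma integral_affine a b h (D : set R) : 0 < a -> measurable D ->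
  measurable_fun D h -> (forall x, D x -> 0 <= h x)%E ->
  (\int[leb]_(x in D) h x =
   a%:E * \int[leb]_(x in (fun x => (a * x + b)%R) @^-1` D) h (a * x + b)%R)%E.
Proof.
move=> a0 mD mh h0; pose k : {nonneg R} := NngNum (ltW a0).
rewrite (@eq_measure_integral _ _ _ _ (mscale k (aff_push a b))); last first.
  by move=> A mA _; exact: lebesgue_measure_affine.
rewrite ge0_integral_mscale//; congr (_ * _)%E.
rewrite -[LHS]/(integral (pushforward leb (aff a b)) D h).
rewrite (@ge0_integral_pushforward _ _ _ _ _ (aff a b))//.
  exact: measurable_affine.
by move=> x /[!inE]; exact: h0.
Qed.

Lemma integral_lebesgue01 h (D : set R) : measurable D -> D `<=` `[0, 1] ->
  (\int[lebesgue01 R]_(x in D) h x = \int[leb]_(x in D) h x)%E.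
Proof.
move=> mD D01; apply: eq_measure_integral => A mA AD.
rewrite /lebesgue01 /mrestr; congr (leb _).
by apply/setIidPl => x /AD /D01.
Qed.

Lemma lebesgue01E (A : set R) : lebesgue01 R A = leb (A `&` `[0, 1]).
Proof. by []. Qed.

End affine.

Section swap.
Context (R : realType) (a m b : R).
Hypotheses (a0 : 0 <= a) (am : a < m) (mb : m < b) (b1 : b <= 1).
Local Notation mu := (lebesgue01 R).
Implicit Types (h : R -> \bar R).

Let I : set R := `]a, m].
Let J : set R := `]m, b].
Let s : R := (b - m) / (m - a).

(** Half-open intervals partition ]a, b] exactly, so [swap] is an involution at every point and not
    merely almost everywhere. The slope [s] is the ratio of the two lengths. *)
Definition swap (x : R) : R :=
  if a < x <= m then s * x + (m - s * a)
  else if m < x <= b then s^-1 * x + (a - s^-1 * m) else x.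

Definition swap_weight (x : R) : R :=
  if a < x <= m then s else if m < x <= b then s^-1 else 1.

Let s0 : 0 < s. Proof. by rewrite divr_gt0// subr_gt0. Qed.
Let sN0 : s != 0. Proof. exact: lt0r_neq0. Qed.

Lemma swap_weight_gt0 x : 0 < swap_weight x.
Proof. by rewrite /swap_weight; do 2 case: ifP => _ //; rewrite invr_gt0. Qed.

Let affI x : (m < s * x + (m - s * a) <= b) = (a < x <= m).
Proof.
have -> : s * x + (m - s * a) = m + s * (x - a) by ring.
rewrite ltrDl pmulr_rgt0// subr_gt0; congr andb.
rewrite -lerBrDl mulrAC ler_pdivrMr ?subr_gt0// ler_pM2l ?subr_gt0//.
by rewrite lerD2r.
Qed.

Let affJ x : (a < s^-1 * x + (a - s^-1 * m) <= m) = (m < x <= b).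
Proof.
have -> : s^-1 * x + (a - s^-1 * m) = a + s^-1 * (x - m) by ring.
rewrite ltrDl pmulr_rgt0 ?invr_gt0// subr_gt0; congr andb.
rewrite -lerBrDl invf_div mulrAC ler_pdivrMr ?subr_gt0// ler_pM2l ?subr_gt0//.
by rewrite lerD2r.
Qed.

Lemma swap_itvl x : (m < swap x <= b) = (a < x <= m).
Proof.
rewrite /swap; case: ifPn => [|xI]; first by rewrite affI.
case: ifPn => xJ.
  by have := xJ; rewrite -affJ => /andP[_]; rewrite leNgt => /negbTE ->.
exact/negbTE.
Qed.

Lemma swap_itvr x : (a < swap x <= m) = (m < x <= b).
Proof.
rewrite /swap; case: ifPn => xI.
  move: (xI); rewrite -affI => /andP[+ _]; rewrite ltNge => /negbTE ->.
  by move: xI => /andP[_]; rewrite leNgt andbF => /negbTE ->.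
by case: ifPn => xJ; [rewrite affJ|exact/negbTE].
Qed.

Lemma swap_itv x : a < x <= b -> a < swap x <= b.
Proof.
move=> /andP[ax xb]; have [xm|mx] := leP x m.
  have : m < swap x <= b by rewrite swap_itvl ax.
  by move=> /andP[/(lt_trans am) -> ->].
have : a < swap x <= m by rewrite swap_itvr mx.
by move=> /andP[-> /le_trans]; apply; exact: ltW.
Qed.

Lemma swapK : involutive swap.
Proof.
move=> x; rewrite {1}/swap swap_itvr swap_itvl.
have [xI|xI] := boolP (a < x <= m).
  rewrite ifF; last by move: xI => /andP[_]; rewrite leNgt => /negbTE ->.
  by rewrite /swap xI; field.
have [xJ|xJ] := boolP (m < x <= b).
  by rewrite /swap (negbTE xI) xJ; field.
by rewrite /swap (negbTE xI) (negbTE xJ).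
Qed.

(** Chain rule for [swapK]. It makes the weighted composition its own inverse, hence surjective. *)
Lemma swap_weightM x : swap_weight x * swap_weight (swap x) = 1.
Proof.
rewrite /swap_weight swap_itvr swap_itvl.
have [/andP[_ xm]|xI] := boolP (a < x <= m).
  by rewrite ltNge xm/= divff// gt_eqF.
by case: ifP => _; rewrite ?mulVf ?mulr1// gt_eqF.
Qed.

Lemma swap_weightl x : a < x <= m -> swap_weight x = (b - m) / (m - a).
Proof. by rewrite /swap_weight => ->. Qed.

Lemma swap_out x : ~~ (a < x <= b) -> swap x = x /\ swap_weight x = 1.
Proof.
move=> xab; rewrite /swap /swap_weight.
have /negbTE-> : ~~ (a < x <= m).
  by apply: contra xab => /andP[-> /le_trans]; apply; exact: ltW.
suff /negbTE-> : ~~ (m < x <= b) by [].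
by apply: contra xab => /andP[/(lt_trans am) -> ->].
Qed.

Lemma measurable_swap_weight : measurable_fun [set: R] swap_weight.
Proof.
apply: measurable_fun_ifT => //; last first.
  apply: measurable_fun_ifT => //.
  by apply: measurable_and; [exact: measurable_fun_ltr|exact: measurable_fun_ler].
by apply: measurable_and; [exact: measurable_fun_ltr|exact: measurable_fun_ler].
Qed.

Lemma measurable_swap : measurable_fun [set: R] swap.
Proof.
apply: measurable_fun_ifT; [|exact: measurable_affine|].
  by apply: measurable_and; [exact: measurable_fun_ltr|exact: measurable_fun_ler].
apply: measurable_fun_ifT; [|exact: measurable_affine|by []].
by apply: measurable_and; [exact: measurable_fun_ltr|exact: measurable_fun_ler].
Qed.

Let mI : measurable I. Proof. exact: measurable_itv. Qed.
Let mJ : measurable J. Proof. exact: measurable_itv. Qed.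
Let I01 : I `<=` `[0, 1].
Proof. apply: subset_itv; rewrite bnd_simp//; exact: le_trans (ltW mb) b1. Qed.
Let J01 : J `<=` `[0, 1].
Proof. apply: subset_itv; rewrite bnd_simp//; exact: le_trans a0 (ltW am). Qed.

Lemma integral_swapl h : measurable_fun [set: R] h -> (forall x, 0 <= h x)%E ->
  (\int[mu]_(x in `]a, m]) ((swap_weight x)%:E * h (swap x)) =
   \int[mu]_(x in `]m, b]) h x)%E.
Proof.
move=> mh h0; rewrite !integral_lebesgue01//.
rewrite (@integral_affine _ s (m - s * a) h)//; last exact: measurable_funTS.
rewrite (_ : _ @^-1` _ = I); last first.
  by apply/seteqP; split => x; rewrite /= !in_itv/= affI.
rewrite -ge0_integralZl_EFin//.
- by apply: eq_integral => x /[!inE]/= /[!in_itv]/= xI; rewrite /swap_weight /swap xI.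
- apply/(measurable_funTS)/measurableT_comp => //; exact: measurable_affine.
- exact: ltW.
Qed.

Lemma integral_swapr h : measurable_fun [set: R] h -> (forall x, 0 <= h x)%E ->
  (\int[mu]_(x in `]m, b]) ((swap_weight x)%:E * h (swap x)) =
   \int[mu]_(x in `]a, m]) h x)%E.
Proof.
move=> mh h0; rewrite !integral_lebesgue01//.
rewrite (@integral_affine _ s^-1 (a - s^-1 * m) h)//; last 2 first.
- by rewrite invr_gt0.
- exact: measurable_funTS.
rewrite (_ : _ @^-1` _ = J); last first.
  by apply/seteqP; split => x; rewrite /= !in_itv/= affJ.
rewrite -ge0_integralZl_EFin//.
- apply: eq_integral => x /[!inE]/= /[!in_itv]/= xJ; rewrite /swap_weight /swap xJ.
  by rewrite ifF//; move: xJ => /andP[]; rewrite ltNge => /negbTE ->; rewrite andbF.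
- apply/(measurable_funTS)/measurableT_comp => //; exact: measurable_affine.
- by rewrite invr_ge0 ltW.
Qed.

Lemma integral_swap h : measurable_fun [set: R] h -> (forall x, 0 <= h x)%E ->
  (\int[mu]_x ((swap_weight x)%:E * h (swap x)) = \int[mu]_x h x)%E.
Proof.
move=> mh h0.
have mwh : measurable_fun [set: R] (fun x => (swap_weight x)%:E * h (swap x))%E.
  apply: emeasurable_funM.
    by apply/measurable_EFinP; exact: measurable_swap_weight.
  apply: measurableT_comp => //; exact: measurable_swap.
have wh0 x : (0 <= (swap_weight x)%:E * h (swap x))%E.
  by rewrite mule_ge0// lee_fin ltW// swap_weight_gt0.
have IJ : I `|` J = `]a, b]%classic.
  by rewrite /I /J -itv_bndbnd_setU// bnd_simp ?ltW.
have disIJ : [disjoint I & J].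
  apply/disj_setPS => x []; rewrite /I /J /= !in_itv/= => /andP[_ xm] /andP[+ _].
  by rewrite ltNge xm.
have mIJ : measurable (I `|` J) by exact: measurableU.
have setTE : [set: R] = (I `|` J) `|` ~` (I `|` J) by rewrite setUv.
have dis : [disjoint I `|` J & ~` (I `|` J)] by apply/disj_setPCl.
(* Cut at ]a, m], ]m, b] and the rest: the swap exchanges the first two integrals and leaves the
   third alone. *)
have key (f : R -> \bar R) : measurable_fun [set: R] f -> (forall x, 0 <= f x)%E ->
    (\int[mu]_x f x = \int[mu]_(x in I) f x + \int[mu]_(x in J) f x +
     \int[mu]_(x in ~` (I `|` J)) f x)%E.
  move=> mf f0; rewrite {1}setTE ge0_integral_setU//; last 2 first.
  - exact: measurableC.
  - by rewrite -setTE.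
  by rewrite ge0_integral_setU//; exact: measurable_funTS.
rewrite key// [RHS]key// integral_swapl// integral_swapr// [X in (X + _)%E]addeC.
congr (_ + _)%E; apply: eq_integral => x; rewrite inE IJ /= in_itv/= => /negP xab.
by have [-> ->] := swap_out xab; rewrite mul1e.
Qed.

End swap.

(** * The complex L^p spaces *)

Lemma powR_cvg0_comp (R : realType) (q : R) (a_ : nat -> R) : 0 < q ->
  (forall n, 0 <= a_ n) -> a_ n @[n --> \oo] --> 0 ->
  (a_ n `^ q) @[n --> \oo] --> 0.
Proof.
move=> q0 a0 /cvgr0_norm_le cva; apply/cvgr0Pnorm_le => e e0.
have /cva : 0 < e `^ q^-1 by rewrite powR_gt0.
apply: filterS => n; rewrite !ger0_norm ?powR_ge0// => ane.
rewrite -[leRHS](powRr1 (ltW e0)) -(mulVf (lt0r_neq0 q0)) powRrM.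
by apply: ge0_ler_powR; rewrite ?nnegrE ?powR_ge0// ltW.
Qed.

Lemma ae_imp d (T : measurableType d) (R : realType)
    (mu : {measure set T -> \bar R}) (P Q : T -> Prop) :
  {ae mu, forall x, P x} -> (forall x, P x -> Q x) -> {ae mu, forall x, Q x}.
Proof. by move=> aeP PQ; apply: filterS aeP. Qed.

Lemma ae_imp2 d (T : measurableType d) (R : realType)
    (mu : {measure set T -> \bar R}) (P Q S : T -> Prop) :
  {ae mu, forall x, P x} -> {ae mu, forall x, Q x} ->
  (forall x, P x -> Q x -> S x) -> {ae mu, forall x, S x}.
Proof. by move=> aeP aeQ PQS; apply: filterS2 aeP aeQ. Qed.

Lemma ae_and d (T : measurableType d) (R : realType)
    (mu : {measure set T -> \bar R}) (P Q : T -> Prop) :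
  {ae mu, forall x, P x} -> {ae mu, forall x, Q x} ->
  {ae mu, forall x, P x /\ Q x}.
Proof. by move=> aeP aeQ; apply: filterS2 aeP aeQ. Qed.

Section Lp_toolkit.
Context d (T : measurableType d) (R : realType).
Variables (mu : {measure set T -> \bar R}) (p : R) (p1 : 1 <= p).
Local Notation Lp := (cLp mu p1).
Implicit Types (u v w : Lp) (f g : T -> R[i]).

Let p0 : 0 < p. Proof. exact: lt_le_trans p1. Qed.

Lemma ReD (y z : R[i]) : complex.Re (y + z) = complex.Re y + complex.Re z.
Proof. by case: y z => ? ? []. Qed.

Lemma ImD (y z : R[i]) : complex.Im (y + z) = complex.Im y + complex.Im z.
Proof. by case: y z => ? ? []. Qed.

Lemma ReM (y z : R[i]) :
  complex.Re (y * z) = complex.Re y * complex.Re z - complex.Im y * complex.Im z.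
Proof. by case: y z => ? ? []. Qed.

Lemma ImM (y z : R[i]) :
  complex.Im (y * z) = complex.Re y * complex.Im z + complex.Im y * complex.Re z.
Proof. by case: y z => ? ? []. Qed.

Lemma normc_real (r : R) : normc r%:C = `|r|.
Proof. by rewrite /= expr0n addr0 sqrtr_sqr. Qed.

Lemma measurable_modulus_powR f : cmeasurable f ->
  measurable_fun setT (fun x => (modulus f x `^ p)%:E).
Proof.
move=> mf; apply/measurable_EFinP.
apply: (@measurableT_comp _ _ _ _ _ _ (@powR R ^~ p)) => //.
exact: measurable_modulus.
Qed.

Lemma Lnorm_modulusE f :
  ('N[mu]_p%:E[EFin \o modulus f] = (\int[mu]_x (modulus f x `^ p)%:E) `^ p^-1)%E.
Proof.
rewrite unlock /=; congr (_ `^ _)%E; apply: eq_integral => x _.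
by rewrite ger0_norm// modulus_ge0.
Qed.

Lemma cLfun_predP f : f \in cLfun_pred mu p <->
  cmeasurable f /\ (\int[mu]_x (modulus f x `^ p)%:E < +oo)%E.
Proof.
rewrite inE; split=> -[mf h]; split=> //; move: h.
  rewrite /finite_norm Lnorm_modulusE; apply: lty_poweRy.
  by rewrite invr_eq0 gt_eqF.
by rewrite /finite_norm Lnorm_modulusE; exact: poweR_lty.
Qed.

Lemma cmeasurable_repr u : cmeasurable (repr u).
Proof. exact: cLfun_cmeasurable. Qed.

Lemma integral_repr_lty u : (\int[mu]_x (modulus (repr u) x `^ p)%:E < +oo)%E.
Proof. by have /cLfun_predP[] := cLfunP (repr u). Qed.

Lemma LpP u v : u = v <-> {ae mu, forall x, repr u x = repr v x}.
Proof. by rewrite -cLp_eqP !reprK. Qed.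

(** [repr] chooses an arbitrary representative, so it respects the operations only almost
    everywhere. Identities in L^p are proved through [LpP] by collecting such statements. *)
Lemma reprD u v : {ae mu, forall x, repr (u + v) x = repr u x + repr v x}.
Proof.
have /cLp_eqP : \pi_Lp (repr (u + v)) = \pi_Lp (repr u + repr v).
  by rewrite pi_addr !reprK.
exact.
Qed.

Lemma reprZ (a : R[i]) u : {ae mu, forall x, repr (a *: u) x = a * repr u x}.
Proof.
have /cLp_eqP : \pi_Lp (repr (a *: u)) = \pi_Lp (a *: repr u).
  by rewrite reprK.
exact.
Qed.

Lemma reprN u : {ae mu, forall x, repr (- u) x = - repr u x}.
Proof.
by rewrite -scaleN1r; apply: filterS (reprZ (-1) u) => x ->; rewrite mulN1r.
Qed.

Lemma reprB u v : {ae mu, forall x, repr (u - v) x = repr u x - repr v x}.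
Proof.
by apply: filterS2 (reprD u (- v)) (reprN v) => x -> ->.
Qed.

Lemma repr0 : {ae mu, forall x, repr (0 : Lp) x = 0}.
Proof.
have := reprZ 0 (0 : Lp); rewrite scale0r.
by apply: filterS => x ->; rewrite mul0r.
Qed.

Lemma LpNormE u :
  `|u| = (fine (\int[mu]_x (modulus (repr u) x `^ p)%:E) `^ p^-1)%:C.
Proof. by rewrite -fine_poweR -Lnorm_modulusE. Qed.

Lemma Lp_norm_eq u v :
  (\int[mu]_x (modulus (repr u) x `^ p)%:E =
   \int[mu]_x (modulus (repr v) x `^ p)%:E)%E -> `|u| = `|v|.
Proof. by rewrite !LpNormE => ->. Qed.

(* The class of [f], or the junk value [0] if [f] is not p-integrable. *)
Definition Lp_of f : Lp := \pi_Lp (insubd (0 : cLfun mu p1) f).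

Lemma Lp_ofE f : f \in cLfun_pred mu p ->
  {ae mu, forall x, repr (Lp_of f) x = f x}.
Proof.
move=> fp; have /cLp_eqP := reprK (Lp_of f).
apply: filterS => x ->.
by rewrite -[LHS]/(val (insubd (0 : cLfun mu p1) f) x) insubdK.
Qed.

Lemma Lp_ge0P u : cLp_ge0 u <-> {ae mu, forall x, 0 <= repr u x}.
Proof. by []. Qed.

Lemma ae_modulus_eq f g : cmeasurable f -> cmeasurable g ->
  {ae mu, forall x, f x = g x} ->
  (\int[mu]_x (modulus f x `^ p)%:E = \int[mu]_x (modulus g x `^ p)%:E)%E.
Proof.
move=> mf mg fg; apply: ae_eq_integral => //; try exact: measurable_modulus_powR.
by apply: filterS fg => x fx _; rewrite /modulus fx.
Qed.

Lemma Lp_of_norm f : f \in cLfun_pred mu p ->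
  (\int[mu]_x (modulus (repr (Lp_of f)) x `^ p)%:E =
   \int[mu]_x (modulus f x `^ p)%:E)%E.
Proof.
move=> fp; apply: ae_modulus_eq; [exact: cmeasurable_repr| |exact: Lp_ofE].
by have /cLfun_predP[] := fp.
Qed.

Lemma modulus_real (g : T -> R) x : modulus (fun x => (g x)%:C) x = `|g x|.
Proof. by rewrite /modulus normc_real. Qed.

Lemma Re_le_modulus f x : `|complex.Re (f x)| <= modulus f x.
Proof.
rewrite /modulus; case: (f x) => a b /=.
by rewrite -sqrtr_sqr ler_wsqrtr// lerDl sqr_ge0.
Qed.

Lemma Im_le_modulus f x : `|complex.Im (f x)| <= modulus f x.
Proof.
rewrite /modulus; case: (f x) => a b /=.
by rewrite -sqrtr_sqr ler_wsqrtr// lerDr sqr_ge0.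
Qed.

Lemma cmeasurable_real (g : T -> R) : measurable_fun setT g ->
  cmeasurable (fun x => (g x)%:C).
Proof. by move=> mg; split => //=; exact: measurable_cst. Qed.

Lemma cLfun_pred_le f g : cmeasurable f -> g \in cLfun_pred mu p ->
  (forall x, modulus f x <= modulus g x) -> f \in cLfun_pred mu p.
Proof.
move=> mf /cLfun_predP[mg gfin] fg; apply/cLfun_predP; split => //.
apply: le_lt_trans gfin; apply: ge0_le_integral => //; try exact: measurable_modulus_powR.
- by move=> x _; rewrite lee_fin powR_ge0.
- move=> x _; rewrite lee_fin.
  by apply: ge0_ler_powR; rewrite ?nnegrE ?modulus_ge0// ltW.
Qed.

Lemma cLfun_pred_bounded (M : R) f : (mu setT < +oo)%E -> cmeasurable f ->
  (forall x, modulus f x <= M) -> f \in cLfun_pred mu p.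
Proof.
move=> muT mf fM.
apply: (@cLfun_pred_le _ (fun=> M%:C)) => //; last first.
  by move=> x; rewrite modulus_real (le_trans (fM x))// ler_norm.
apply/cLfun_predP; split; first by apply: cmeasurable_real; exact: measurable_cst.
under eq_integral do rewrite modulus_real.
rewrite integral_cst// lte_mul_pinfty// ?lee_fin ?powR_ge0//.
Qed.

Lemma cLfun_pred_indic (A : set T) : (mu setT < +oo)%E -> measurable A ->
  (fun x => (\1_A x)%:C : R[i]) \in cLfun_pred mu p.
Proof.
move=> muT mA; apply: (@cLfun_pred_bounded 1) => //.
  by apply: cmeasurable_real; exact: measurable_indic.
by move=> x; rewrite modulus_real indicE; case: (_ \in _); rewrite ?normr1 ?normr0.
Qed.

(** Dominated convergence for |u - u_n|^p with majorant |u|^p. This majorant suits approximation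
    from below, by partial unions of sets or by simple functions under a nonnegative function. *)
Lemma Lp_dominated_cvg (u_ : nat -> Lp) u :
  (forall n, {ae mu, forall x, modulus (repr (u - u_ n)) x <= modulus (repr u) x}) ->
  {ae mu, forall x, modulus (repr (u - u_ n)) x @[n --> \oo] --> 0} ->
  u_ n @[n --> \oo] --> u.
Proof.
move=> dom cv.
have mpow v : measurable_fun setT (fun x => (modulus (repr v) x `^ p)%:E).
  by apply: measurable_modulus_powR; exact: cmeasurable_repr.
have [] := @dominated_convergence _ _ _ mu setT measurableT
  (fun n x => (modulus (repr (u - u_ n)) x `^ p)%:E) (cst 0)
  (fun x => (modulus (repr u) x `^ p)%:E) (fun n => mpow _) (measurable_cst _).
- apply: filterS cv => x cvx _; apply: cvg_EFin; first exact: nearW.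
  by apply: powR_cvg0_comp => // n; exact: modulus_ge0.
- apply/integrableP; split => //.
  under eq_integral do rewrite gee0_abs ?lee_fin ?powR_ge0//.
  exact: integral_repr_lty.
- apply: (@ae_foralln _ _ _ mu (fun n x => setT x -> _)) => n.
  apply: filterS (dom n) => x le _; rewrite gee0_abs ?lee_fin ?powR_ge0//.
  by apply: ge0_ler_powR; rewrite ?nnegrE ?modulus_ge0// ltW.
move=> _ _; rewrite integral0 => h.
have {}h : fine (\int[mu]_x (modulus (repr (u - u_ n)) x `^ p)%:E) @[n --> \oo]
    --> (0 : R).
  exact: (fine_cvg h).
have {}h : fine (\int[mu]_x (modulus (repr (u - u_ n)) x `^ p)%:E) `^ p^-1
    @[n --> \oo] --> (0 : R).
  apply: powR_cvg0_comp; rewrite ?invr_gt0// => n.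
  by rewrite fine_ge0// integral_ge0// => x _; rewrite lee_fin powR_ge0.
(* Norms take values in R[i], so [e] is a complex number; its positivity forces it to be real. *)
apply/cvgrPdist_le => e e0.
have e0' : 0 < complex.Re e by move: e0; rewrite ltcE => /andP[].
have eE : e = (complex.Re e)%:C.
  by move: e0; rewrite ltcE /=; case: e {e0'} => x y /= /andP[/eqP ->].
have /cvgr0_norm_le /(_ _ e0') := h.
apply: filterS => n hn; rewrite LpNormE eE lecR (le_trans _ hn)//.
exact: ler_norm.
Qed.

End Lp_toolkit.

Lemma linear_lipschitz_continuous (K : numFieldType) (E F : normedModType K)
    (f : {linear E -> F}) (C : K) :
  0 <= C -> (forall u, `|f u| <= C * `|u|) -> continuous f.
Proof.
move=> C0 fC; apply/linear_bounded_continuous/linear_boundedP.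
near=> r => u; apply: le_trans (fC u) _; apply: ler_wpM2r => //.
by near: r; apply: nbhs_pinfty_ge; exact: ger0_real.
Unshelve. all: by end_near. Qed.

(** * Weighted compositions as positive invertible isometries *)

Section weighted_composition.
Context d (T : measurableType d) (R : realType).
Variables (mu : {measure set T -> \bar R}) (p : R) (p1 : 1 <= p).
Variables (phi : T -> T) (w : T -> R).
Hypotheses (mphi : measurable_fun setT phi) (mw : measurable_fun setT w).
Hypotheses (w0 : forall x, 0 < w x) (phiK : involutive phi).
Hypothesis wM : forall x, w x * w (phi x) = 1.
Hypothesis change_of_variables : forall h : T -> \bar R,
  measurable_fun setT h -> (forall x, 0 <= h x)%E ->
  (\int[mu]_x ((w x)%:E * h (phi x)) = \int[mu]_x h x)%E.
Local Notation Lp := (cLp mu p1).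

Let p0 : 0 < p. Proof. exact: lt_le_trans p1. Qed.

(** For a null set N, the change of variables gives w * (1_N o phi) integral 0, and w > 0 then makes
    the preimage of N null. Composition with [phi] is therefore well defined on classes. *)
Lemma ae_comp (P : T -> Prop) :
  {ae mu, forall x, P x} -> {ae mu, forall x, P (phi x)}.
Proof.
move=> [N [mN N0 PN]].
have mphiN : measurable (phi @^-1` N) by rewrite -[X in measurable X]setTI; exact: mphi.
have mwN : measurable_fun setT (fun x => (w x)%:E * (\1_N (phi x))%:E)%E.
  apply: emeasurable_funM; first by apply/measurable_EFinP.
  apply/measurable_EFinP/(measurableT_comp _ mphi); exact: measurable_indic.
have : (\int[mu]_x `|(w x)%:E * (\1_N (phi x))%:E| = 0)%E.
  under eq_integral do rewrite gee0_abs ?mule_ge0 ?lee_fin ?(ltW (w0 _)) ?indicE//.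
  rewrite (change_of_variables (h := fun x => (\1_N x)%:E))//.
  - by rewrite integral_indic// setIT.
  - by apply/measurable_EFinP; exact: measurable_indic.
move/(ae_eq_integral_abs _ measurableT mwN).
apply: filterS => x /(_ Logic.I) /eqP.
rewrite -EFinM eqe mulf_eq0 gt_eqF//= indicE pnatr_eq0 eqb0 notin_setE => Nx.
by apply: contrapT => nP; apply: Nx; exact: PN.
Qed.

Let wcf (u : Lp) x : R[i] := (w x `^ p^-1)%:C * repr u (phi x).

Let mwp : measurable_fun setT (fun x => w x `^ p^-1).
Proof. by apply: (measurableT_comp (f := @powR R ^~ p^-1)). Qed.

Let wcf_measurable u : cmeasurable (wcf u).
Proof.
have [mRe mIm] := cmeasurable_repr u.
split.
- rewrite (_ : (fun _ => _) =
      (fun x => w x `^ p^-1 * complex.Re (repr u (phi x)))).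
    by apply: measurable_funM => //; exact: (measurableT_comp mRe).
  by apply/funext => x; rewrite ReM/= mul0r subr0.
- rewrite (_ : (fun _ => _) =
      (fun x => w x `^ p^-1 * complex.Im (repr u (phi x)))).
    by apply: measurable_funM => //; exact: (measurableT_comp mIm).
  by apply/funext => x; rewrite ImM/= mul0r addr0.
Qed.

Let wcf_modulus u x :
  modulus (wcf u) x `^ p = w x * modulus (repr u) (phi x) `^ p.
Proof.
rewrite /modulus /wcf normcM normc_real ger0_norm ?powR_ge0//.
rewrite powRM ?powR_ge0//; last exact: (modulus_ge0 (repr u) (phi x)).
by rewrite -powRrM mulVf ?gt_eqF// powRr1// ltW.
Qed.

Let wcf_integral u : (\int[mu]_x (modulus (wcf u) x `^ p)%:E =
  \int[mu]_x (modulus (repr u) x `^ p)%:E)%E.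
Proof.
under eq_integral do rewrite wcf_modulus EFinM.
rewrite (change_of_variables (h := fun x => (modulus (repr u) x `^ p)%:E))//.
- by apply: measurable_modulus_powR; exact: cmeasurable_repr.
- by move=> x; rewrite lee_fin powR_ge0.
Qed.

Let wcf_pred u : wcf u \in cLfun_pred mu p.
Proof.
apply/(cLfun_predP mu p1); split; first exact: wcf_measurable.
by rewrite wcf_integral integral_repr_lty.
Qed.

Let wc (u : Lp) : Lp := Lp_of mu p1 (wcf u).

Let wcE u : {ae mu, forall x, repr (wc u) x = (w x `^ p^-1)%:C * repr u (phi x)}.
Proof. exact: (Lp_ofE p1 (wcf_pred u)). Qed.

Let wc_linear : linear wc.
Proof.
move=> a u v; apply/LpP.
have h1 := wcE (a *: u + v).
have h2 := ae_comp (reprD (a *: u) v).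
have h3 := ae_comp (reprZ a u).
have h4 := reprD (a *: wc u) (wc v).
have h5 := reprZ a (wc u).
have h6 := wcE u.
have h7 := wcE v.
apply: filterS2 (filterI h1 (filterI h2 h3)) (filterI h4 (filterI h5 (filterI h6 h7))).
move=> x [-> [-> ->]] [-> [-> [-> ->]]].
by rewrite mulrDr mulrCA.
Qed.

Let wcK : involutive wc.
Proof.
move=> u; apply/LpP; apply: filterS2 (wcE (wc u)) (ae_comp (wcE u)) => x -> ->.
by rewrite phiK mulrA -rmorphM -powRM ?(ltW (w0 _))// wM powR1 mul1r.
Qed.

Let wc_norm u : `|wc u| = `|u|.
Proof. by apply: Lp_norm_eq; rewrite Lp_of_norm// wcf_integral. Qed.

Lemma weighted_composition_ex : exists S : operator Lp Lp,
  positive_invertible_isometries mu p1 S /\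
  forall u, {ae mu, forall x, repr (S u) x = (w x `^ p^-1)%:C * repr u (phi x)}.
Proof.
pose L : {linear Lp -> Lp} := HB.pack wc (GRing.isLinear.Build _ _ _ _ wc wc_linear).
have Lc : continuous L.
  by apply: (@linear_lipschitz_continuous _ _ _ _ 1) => // u; rewrite mul1r wc_norm.
exists (Operator Lc); split; last exact: wcE.
split; last by move=> v; exists (wc v); exact: wcK.
split; last exact: wc_norm.
move=> u /Lp_ge0P u0; apply/Lp_ge0P.
apply: filterS2 (wcE u) (ae_comp u0) => x -> ux.
by rewrite mulr_ge0// lecR powR_ge0.
Qed.

End weighted_composition.

(** * Integrals over sets as bounded functionals *)

Section functionals.
Context d (T : measurableType d) (R : realType).
Variables (mu : {measure set T -> \bar R}) (p : R) (hp : 1 < p).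
Hypothesis mu1 : mu setT = 1%E.
Local Notation Lp := (cLp mu (ltW hp)).
Implicit Types (u v : Lp) (A : set T).

Let p0 : 0 < p. Proof. exact: lt_trans hp. Qed.

(** Hölder's inequality against the constant 1, whose norm is 1 because [mu] has mass 1; [q] is the
    conjugate exponent. *)
Lemma integral_modulus_le u :
  (\int[mu]_x (modulus (repr u) x)%:E <= (complex.Re `|u|)%:E)%E.
Proof.
pose q := (1 - p^-1)^-1.
have pV1 : 0 < 1 - p^-1 by rewrite subr_gt0 invf_lt1.
have q0 : 0 < q by rewrite invr_gt0.
have pq : p^-1 + q^-1 = 1 by rewrite invrK addrC subrK.
have mu_ := measurable_modulus (cmeasurable_repr u).
have := hoelder mu mu_ (@measurable_cst _ _ T _ setT (1 : R)) p0 q0 pq.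
rewrite Lnorm1 /= -[X in Lnorm mu q%:E X]/(cst 1%E) Lnorm_cst1 mu1 poweR1r mule1.
rewrite -[X in (_ <= X)%E](cLfun_fin_norm (repr u)).
apply: le_trans; rewrite le_eqVlt; apply/orP; left; apply/eqP.
by apply: eq_integral => x _; rewrite mulr1 ger0_norm// modulus_ge0.
Qed.

Lemma integrable_modulus u : mu.-integrable setT (EFin \o modulus (repr u)).
Proof.
apply/integrableP; split.
  exact/measurable_EFinP/measurable_modulus/cmeasurable_repr.
under eq_integral do rewrite /= ger0_norm ?modulus_ge0//.
exact: le_lt_trans (integral_modulus_le u) (ltry _).
Qed.

Lemma integrable_Re A u : measurable A ->
  mu.-integrable A (EFin \o (fun x => complex.Re (repr u x))).
Proof.
move=> mA; apply: (integrableS measurableT) => //.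
apply: le_integrable (integrable_modulus u) => //.
  by apply/measurable_EFinP; have [] := cmeasurable_repr u.
by move=> x _ /=; rewrite lee_fin (le_trans (Re_le_modulus _ _))// ler_norm.
Qed.

Lemma integrable_Im A u : measurable A ->
  mu.-integrable A (EFin \o (fun x => complex.Im (repr u x))).
Proof.
move=> mA; apply: (integrableS measurableT) => //.
apply: le_integrable (integrable_modulus u) => //.
  by apply/measurable_EFinP; have [] := cmeasurable_repr u.
by move=> x _ /=; rewrite lee_fin (le_trans (Im_le_modulus _ _))// ler_norm.
Qed.

(** The pairing with the indicator of [A]. By [integral_on_inj] these functionals already separate
    points, so no description of the whole dual is called for. *)
Definition integral_on A u : R[i] :=
  (\int[mu]_(x in A) complex.Re (repr u x)) +i*
  (\int[mu]_(x in A) complex.Im (repr u x)).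

Lemma ae_eq_Rintegral A (f g : T -> R) : measurable A ->
  measurable_fun A f -> measurable_fun A g ->
  {ae mu, forall x, f x = g x} ->
  \int[mu]_(x in A) f x = \int[mu]_(x in A) g x.
Proof.
move=> mA mf mg fg; congr fine; apply: ae_eq_integral => //.
- exact/measurable_EFinP.
- exact/measurable_EFinP.
- by apply: filterS fg => x -> .
Qed.

Let mRe A u : measurable_fun A (fun x => complex.Re (repr u x)).
Proof. by apply: measurable_funTS; have [] := cmeasurable_repr u. Qed.
Let mIm A u : measurable_fun A (fun x => complex.Im (repr u x)).
Proof. by apply: measurable_funTS; have [] := cmeasurable_repr u. Qed.

Lemma integral_on_linear A : measurable A ->
  linear (integral_on A : Lp -> R[i]^o).
Proof.
move=> mA a u v.
have iZ (c : R) (f : T -> R) : mu.-integrable A (EFin \o f) ->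
    mu.-integrable A (EFin \o (fun x => c * f x)).
  by move=> fi; exact: (integrableZl mA c fi).
have iR := integrable_Re _ mA; have iI := integrable_Im _ mA.
have uv : {ae mu, forall x, repr (a *: u + v) x = a * repr u x + repr v x}.
  by apply: filterS2 (reprD (a *: u) v) (reprZ a u) => x -> ->.
apply/eqP; rewrite eq_complex /=; apply/andP; split; apply/eqP.
- rewrite ReD -[a *: integral_on A u]/(a * integral_on A u) ReM /=.
  rewrite (@ae_eq_Rintegral _ _ (fun x =>
      (complex.Re a * complex.Re (repr u x) + (- complex.Im a) * complex.Im (repr u x))
      + complex.Re (repr v x)))//.
  + rewrite !RintegralD// ?RintegralZl//; try exact: iZ.
    * by rewrite mulNr.
    * exact: (integrableD mA (iZ (complex.Re a) _ (iR u)) (iZ (- complex.Im a) _ (iI u))).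
  + apply: measurable_funD => //; apply: measurable_funD; exact: measurable_funM.
  + by apply: filterS uv => x ->; rewrite ReD ReM mulNr.
- rewrite ImD -[a *: integral_on A u]/(a * integral_on A u) ImM /=.
  rewrite (@ae_eq_Rintegral _ _ (fun x =>
      (complex.Re a * complex.Im (repr u x) + complex.Im a * complex.Re (repr u x))
      + complex.Im (repr v x)))//.
  + rewrite !RintegralD// ?RintegralZl//; try exact: iZ.
    exact: (integrableD mA (iZ (complex.Re a) _ (iI u)) (iZ (complex.Im a) _ (iR u))).
  + apply: measurable_funD => //; apply: measurable_funD; exact: measurable_funM.
  + by apply: filterS uv => x ->; rewrite ImD ImM.
Qed.

Let Rintegral_le A u (f : T -> R) : measurable A -> measurable_fun setT f ->
  (forall x, `|f x| <= modulus (repr u) x) ->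
  `|\int[mu]_(x in A) f x| <= complex.Re `|u|.
Proof.
move=> mA mf fu.
have fi : mu.-integrable setT (EFin \o f).
  apply: le_integrable (integrable_modulus u) => //.
    exact/measurable_EFinP.
  by move=> x _ /=; rewrite lee_fin (le_trans (fu _))// ler_norm.
have fiA := integrableS measurableT mA (@subsetT _ _) fi.
apply: le_trans (le_normr_Rintegral mA fiA) _.
rewrite -lee_fin /Rintegral fineK; last first.
  by apply: integrable_fin_num => //; exact: integrable_norm.
apply: le_trans (integral_modulus_le u).
apply: (@le_trans _ _ (\int[mu]_x `|f x|%:E)%E).
  apply: ge0_subset_integral => //.
  by apply/measurable_EFinP; exact: measurableT_comp.
apply: ge0_le_integral => //.
- by apply/measurable_EFinP; exact: measurableT_comp.
- exact/measurable_EFinP/measurable_modulus/cmeasurable_repr.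
- by move=> x _; rewrite lee_fin.
Qed.

(** The sharp constant 1 matters here: it is what bounds the scalar by 1 in
    [limit_semigroup_scalar_le1]. *)
Lemma Re_integral_on_le A u : measurable A ->
  complex.Re (integral_on A u) <= complex.Re `|u|.
Proof.
move=> mA; apply: le_trans (ler_norm _) _.
apply: Rintegral_le => //; exact: Re_le_modulus.
Qed.

Lemma integral_on_functional A : measurable A ->
  exists phi : operator Lp R[i]^o, forall u, phi u = integral_on A u.
Proof.
move=> mA.
pose L : {linear Lp -> R[i]^o} :=
  HB.pack (integral_on A) (GRing.isLinear.Build _ _ _ _ _ (integral_on_linear mA)).
suff Lc : continuous L by exists (Operator Lc).
(* The constant 2 comes from estimating the real and imaginary parts separately; continuity asks for
   nothing sharper. *)
apply: (@linear_lipschitz_continuous _ _ _ _ 2%:R) => // u.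
rewrite -[L u]/(integral_on A u) (complexE (integral_on A u)).
apply: le_trans (ler_normD _ _) _.
have normE : `|u| = (complex.Re `|u|)%:C by [].
have i1 : `|'i%C : R[i]| = 1.
  by rewrite -[LHS]/(normc _)%:C /= expr0n add0r expr1n sqrtr1.
rewrite normrM i1 mul1r -[`|_%:C|]/(normc _)%:C -[X in _ + X]/(normc _)%:C.
rewrite !normc_real mulr_natl mulr2n normE.
apply: lerD; rewrite lecR; apply: Rintegral_le => //.
- exact: Re_le_modulus.
- exact: Im_le_modulus.
Qed.

(** Integrable functions with equal integrals over all measurable sets agree almost everywhere; this
    is applied to real and imaginary parts. It turns identities tested on functionals into
    identities in L^p. *)
Lemma integral_on_inj u v :
  (forall A, measurable A -> integral_on A u = integral_on A v) -> u = v.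
Proof.
move=> uv; apply/LpP.
have key (f g : T -> R) : mu.-integrable setT (EFin \o f) ->
    mu.-integrable setT (EFin \o g) ->
    (forall A, measurable A -> \int[mu]_(x in A) f x = \int[mu]_(x in A) g x) ->
    {ae mu, forall x, f x = g x}.
  move=> fi gi fg.
  have : ae_eq mu setT (EFin \o f) (EFin \o g).
    apply: integral_ae_eq => //; first exact: measurable_int gi.
    move=> E _ mE; have /(congr1 (@EFin R)) := fg _ mE.
    rewrite /Rintegral.
    have fiE := integrableS measurableT mE (@subsetT _ _) fi.
    have giE := integrableS measurableT mE (@subsetT _ _) gi.
    by rewrite !fineK// integrable_fin_num.
  by apply: filterS => x /(_ Logic.I) [].
have hR : {ae mu, forall x, complex.Re (repr u x) = complex.Re (repr v x)}.
  apply: key; [exact: integrable_Re|exact: integrable_Re|].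
  by move=> A mA; have [] := uv A mA.
have hI : {ae mu, forall x, complex.Im (repr u x) = complex.Im (repr v x)}.
  apply: key; [exact: integrable_Im|exact: integrable_Im|].
  by move=> A mA; have [] := uv A mA.
apply: filterS2 hR hI => x; case: (repr u x) (repr v x) => ? ? [? ?] /=.
by move=> -> ->.
Qed.

End functionals.

(** * Commutation relations in the operator topologies *)

Lemma op_exp_comm (K : numFieldType) (E : normedModType K) (T : operator E E) n u :
  op_exp T n (T u) = T (op_exp T n u).
Proof. by elim: n => //= n IH; rewrite -[LHS]/(T (op_exp T n (T u))) IH. Qed.

Section operator_topologies.
Context (K : numFieldType) (E : normedModType K).
Implicit Types (u : E) (phi : operator E K^o) (S T V : operator E E).

Lemma sot_eval_continuous u : continuous (fun S : sot E => S u).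
Proof.
move=> S; apply: (@continuous_comp _ _ _
  (fun T : sot E => (T : E -> E) : {ptws E -> E}) (fun f => f u)).
  exact: initial_continuous.
exact: (@proj_continuous {classic E} (fun=> E) u).
Qed.

Lemma wot_eval_continuous u phi :
  continuous (fun S : wot E => (phi (S u) : K^o)).
Proof.
move=> S; apply: (@continuous_comp _ _ _
  (fun T : wot E => (fun uphi => uphi.2 (T uphi.1)) :
     {ptws (E * operator E K^o) -> K^o}) (fun f => f (u, phi))).
  exact: initial_continuous.
exact: (@proj_continuous {classic (E * operator E K^o)} (fun=> K^o) (u, phi)).
Qed.

(** Absorbing a fixed operator into the functional makes multiplication by it on the left weakly
    continuous. *)
Lemma functional_comp S phi : exists psi : operator E K^o, forall u, psi u = phi (S u).
Proof.
have c : continuous (phi \o S : {linear E -> K^o}).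
  by move=> x; apply: continuous_comp; exact: operator_continuous.
by exists (Operator c).
Qed.

(** The sequences phi (T^(n_k) (T u)) and (phi o T) (T^(n_k) u) coincide, and their limits are the
    two sides. *)
Lemma limit_semigroup_commute T V phi u :
  limit_semigroup T V -> phi (V (T u)) = phi (T (V u)).
Proof.
move=> [n [_ nV]].
have [psi psiE] := functional_comp T phi.
have ev w (chi : operator E K^o) :
    (chi (op_exp T (n k) w) : K^o) @[k --> \oo] --> (chi (V w) : K^o).
  exact: (cvg_comp _ _ nV (@wot_eval_continuous w chi V)).
have h1 := ev (T u) phi.
have h2 := ev u psi.
rewrite psiE in h2; apply: (cvg_unique _ h1) => //.
apply: cvg_trans h2; apply: near_eq_cvg; near=> k.
by rewrite psiE op_exp_comm.
Unshelve. all: by end_near. Qed.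

End operator_topologies.

(** The points of [A] where [f] and [g] differ form a relatively open set, which would meet [D] if
    it were nonempty. *)
Lemma dense_in_eq (K : numFieldType) (X : topologicalType) (A D : set X)
    (f g : X -> K^o) :
  continuous f -> continuous g -> (forall x, A x -> D x -> f x = g x) ->
  dense_in A D -> forall x, A x -> f x = g x.
Proof.
move=> cf cg fg AD x Ax; apply: contrapT => fgx.
pose O : set A := ((f \- g) \o set_val) @^-1` [set y | y != 0].
have [] := AD O.
- by exists (SigSub (mem_set Ax)); apply/eqP => /subr0_eq.
- apply: (open_comp (f := (f \- g) \o set_val)); last first.
    rewrite (_ : [set y | _] = ~` [set 0 : K^o]); last first.
      by apply/seteqP; split=> y /= /eqP.
    apply: closed_openC; apply: accessible_closed_set1.
    exact/hausdorff_accessible/norm_hausdorff.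
  move=> y _; apply: continuous_comp; first exact: initial_continuous.
  by apply: continuousB; [exact: cf|exact: cg].
- move=> y [/eqP Oy Dy]; apply: Oy; apply/eqP; rewrite /= subr_eq0.
  by apply/eqP; exact: (fg (val y) (set_mem (valP y)) Dy).
Qed.

Lemma dense_in_ex (X : topologicalType) (A D : set X) x :
  dense_in A D -> A x -> exists y, A y /\ D y.
Proof.
move=> AD Ax; have [||y [_ Dy]] := AD setT; last first.
- exists (val y); split; [exact/set_mem/(valP y)|exact: Dy].
- exact: openT.
- by exists (SigSub (mem_set Ax)).
Qed.

(** * Induction on Borel sets from tails *)

Lemma measurable_tails_ind (R : realType) (P : set (set R)) :
  P setT -> (forall c, P `]c, +oo[%classic) ->
  (forall A, measurable A -> P A -> P (~` A)) ->
  (forall F : (set R)^nat, (forall n, measurable (F n)) -> trivIset setT F ->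
    (forall n, P (F n)) -> P (\bigcup_n F n)) ->
  forall A, measurable A -> P A.
Proof.
move=> PT Pc PC PU A mA.
have mE : @measurable _ (measurableTypeR R) = <<s @RGenOInfty.G R >>.
  exact: RGenOInfty.measurableE.
(* Two tails meet in the tail of the larger endpoint. Tails thus form a generating pi-system, and
   only complements and disjoint unions remain to be checked. *)
have GI : setI_closed (@RGenOInfty.G R).
  move=> _ _ [x ->] [y ->]; exists (Num.max x y).
  apply/seteqP; split => z; rewrite /= !in_itv/= !andbT gt_max => /andP//.
have GP : @RGenOInfty.G R `<=` P by move=> _ [c ->].
apply: (dynkin_induction mE GI PT GP PC PU).
by rewrite -mE.
Qed.

Lemma integral_tails_eq0 (R : realType) (mu : {measure set (measurableTypeR R) -> \bar R})
    (f : R -> \bar R) : mu.-integrable setT f ->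
  (\int[mu]_x f x = 0)%E ->
  (forall c, \int[mu]_(x in `]c, +oo[) f x = 0)%E ->
  forall A, measurable A -> (\int[mu]_(x in A) f x = 0)%E.
Proof.
move=> fi fT fc.
have mf (A : set R) : measurable_fun A f.
  by apply: measurable_funTS; exact: measurable_int fi.
apply: measurable_tails_ind => //.
- move=> A mA fA.
  have := integral_setU mu mA (measurableC mA) (mf _).
  by rewrite setUv fT fA add0e => <- //; apply/disj_setPCl.
- move=> F mF tF fF; rewrite integral_bigcup//.
    by rewrite eseries0// => n _ _; exact: fF.
  by apply: integrableS fi => //; exact: bigcupT_measurable.
Qed.

(** * Closed subspaces containing the indicators *)

Section total.
Context d (T : measurableType d) (R : realType).
Variables (mu : {measure set T -> \bar R}) (p : R) (p1 : 1 <= p).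
Hypothesis muT : (mu setT < +oo)%E.
Local Notation Lp := (cLp mu p1).

Definition Lp_indic (A : set T) : Lp := Lp_of mu p1 (fun x => (\1_A x)%:C).

Lemma Lp_indicE A : measurable A ->
  {ae mu, forall x, repr (Lp_indic A) x = (\1_A x)%:C}.
Proof. by move=> mA; apply: Lp_ofE; exact: (cLfun_pred_indic p1). Qed.

Lemma Lp_indicU A B : measurable A -> measurable B -> A `&` B = set0 ->
  Lp_indic (A `|` B) = Lp_indic A + Lp_indic B.
Proof.
move=> mA mB AB; apply/LpP.
apply: filterS2 (filterI (Lp_indicE (measurableU _ _ mA mB))
  (reprD (Lp_indic A) (Lp_indic B)))
  (filterI (Lp_indicE mA) (Lp_indicE mB)) => x [-> ->] [-> ->].
rewrite !indicE in_setU -rmorphD /= -natrD; congr (_%:R%:C).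
have : ~ (x \in A /\ x \in B).
  by rewrite !inE => ABx; have : (A `&` B) x by []; rewrite AB.
by case: (x \in A) (x \in B) => -[]// [].
Qed.

(** A sequentially closed subspace given as a predicate, later instantiated by the equation V u =
    lam u. *)
Variable P : Lp -> Prop.
Hypothesis P_linear : forall a u v, P u -> P v -> P (a *: u + v).
Hypothesis P_closed : forall (u_ : nat -> Lp) u,
  (forall n, P (u_ n)) -> u_ n @[n --> \oo] --> u -> P u.

(** The indicators of the partial unions converge in norm by dominated convergence. This is the
    disjoint-union step of the induction that establishes [P_indic], so it precedes that hypothesis
    and takes [P 0] as a premise. *)
Lemma closed_indic_bigcup (F : (set T)^nat) : P 0 ->
  (forall n, measurable (F n)) -> trivIset setT F ->
  (forall n, P (Lp_indic (F n))) -> P (Lp_indic (\bigcup_n F n)).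
Proof.
move=> P0 mF tF PF; pose U n := \big[setU/set0]_(i < n) F i.
have mU n : measurable (U n) by exact: bigsetU_measurable.
have UE n : U n = \bigcup_(i < n) F i by rewrite bigcup_mkord.
have mF_ : measurable (\bigcup_n F n) by exact: bigcupT_measurable.
have PU n : P (Lp_indic (U n)).
  elim: n => [|n IH].
    suff -> : Lp_indic (U 0%N) = 0 by [].
    apply/LpP; apply: filterS2 (Lp_indicE (mU 0%N)) (repr0 mu p1) => x -> ->.
    by rewrite /U big_ord0 indic0.
  rewrite /U big_ord_recr /= (Lp_indicU (mU n) (mF n)).
    by rewrite -[X in P (X + _)]scale1r; exact: P_linear.
  rewrite -/(U n) UE; apply/seteqP; split => // x [[i /= ni Fi] Fn].
  move/trivIsetP : tF => /(_ i n Logic.I Logic.I).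
  by rewrite neq_ltn ni => /(_ isT) FF; have : (F i `&` F n) x by []; rewrite FF.
have diff n : {ae mu, forall x,
    repr (Lp_indic (\bigcup_n F n) - Lp_indic (U n)) x =
    (\1_(\bigcup_n F n) x - \1_(U n) x)%:C}.
  apply: filterS2 (reprB (Lp_indic (\bigcup_n F n)) (Lp_indic (U n)))
    (filterI (Lp_indicE mF_) (Lp_indicE (mU n))) => x -> [-> ->].
  by rewrite rmorphB.
have UF n x : x \in U n -> x \in \bigcup_n F n.
  by rewrite !inE UE => -[i _ Fi]; exists i.
apply: (P_closed PU); apply: Lp_dominated_cvg.
- move=> n; apply: filterS2 (diff n) (Lp_indicE mF_) => x xd xF.
  rewrite /modulus xd xF !normc_real !indicE.
  have := @UF n x; case: (x \in U n); case: (x \in _) => // h;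
    rewrite ?subrr ?subr0 ?normr0//.
  by have := h isT.
- apply: filterS (ae_foralln diff) => x xd.
  apply: cvg_near_cst.
  have [[k _ Fk]|nF] := pselect ((\bigcup_n F n) x); last first.
    apply: nearW => n; rewrite /modulus xd !indicE (memNset nF) memNset ?subrr ?normc0//.
    by move=> Ux; apply: nF; apply/set_mem/(@UF n)/mem_set.
  near=> n; have Ux : U n x.
    by rewrite UE; exists k => //=; near: n; exact: nbhs_infty_gt.
  by rewrite /modulus xd !indicE (mem_set Ux) (UF n) ?subrr ?normc0//; exact: mem_set.
Unshelve. all: by end_near. Qed.

Let Lp_real (g : T -> R) : Lp := Lp_of mu p1 (fun x => (g x)%:C).

Hypothesis P_indic : forall A, measurable A -> P (Lp_indic A).

Let P0 : P 0.
Proof.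
have PT := P_indic measurableT.
by have := P_linear (-1) PT PT; rewrite scaleN1r addNr.
Qed.

Let PZ a u : P u -> P (a *: u).
Proof. by move=> Pu; rewrite -[_ *: _]addr0; exact: P_linear. Qed.

Let PD u v : P u -> P v -> P (u + v).
Proof. by move=> Pu Pv; rewrite -[u]scale1r; exact: P_linear. Qed.

Import HBNNSimple.

Let P_nnsfun (f : {nnsfun T >-> R}) : P (Lp_real f).
Proof.
pose s := finmap.enum_fset (fset_set (range f)).
have mY y : measurable (f @^-1` [set y]) by exact: measurable_sfunP.
have : P (\sum_(y <- s) y%:C *: Lp_indic (f @^-1` [set y])).
  elim: s => [|y s IH]; first by rewrite big_nil.
  by rewrite big_cons; apply: PD => //; apply: PZ; exact: P_indic.
suff -> : Lp_real f = \sum_(y <- s) y%:C *: Lp_indic (f @^-1` [set y]) by [].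
have sumE (l : seq R) : {ae mu, forall x,
    repr (\sum_(y <- l) y%:C *: Lp_indic (f @^-1` [set y]) : Lp) x =
    (\sum_(y <- l) y * \1_(f @^-1` [set y]) x)%:C}.
  elim: l => [|y l IH].
    by rewrite big_nil; apply: filterS (repr0 mu p1) => x ->; rewrite big_nil.
  rewrite big_cons.
  apply: filterS2 (filterI IH (Lp_indicE (mY y)))
    (filterI (reprD (y%:C *: Lp_indic (f @^-1` [set y]))
       (\sum_(y <- l) y%:C *: Lp_indic (f @^-1` [set y])))
     (reprZ y%:C (Lp_indic (f @^-1` [set y])))) => x [IHx Ix] [-> ->].
  by rewrite IHx Ix big_cons rmorphD rmorphM.
have fp : (fun x => (f x)%:C) \in cLfun_pred mu p.
  have [M [_ fM]] := simple_bounded f.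
  (* [simple_bounded] makes every constant strictly above [M] a bound, whence M + 1. *)
  apply: (@cLfun_pred_bounded _ _ _ mu p p1 (M + 1)) => //.
  by move=> x; rewrite modulus_real; apply: fM; rewrite ?ltrDl.
apply/LpP; apply: filterS2 (Lp_ofE p1 fp) (sumE s) => x -> ->.
by rewrite fimfunE fsbig_finite//=; exact: fimfunP.
Qed.

Let P_ge0 (g : T -> R) : measurable_fun setT g -> (forall x, 0 <= g x) ->
  (fun x => (g x)%:C) \in cLfun_pred mu p -> P (Lp_real g).
Proof.
move=> mg g0 gp.
have mEg : measurable_fun setT (EFin \o g) by exact/measurable_EFinP.
pose g_ := nnsfun_approx measurableT mEg.
have g_le n x : 0 <= g_ n x <= g x.
  apply/andP; split; first exact: fun_ge0.
  rewrite -lee_fin /g_ nnsfun_approxE; apply: le_approx => // y _.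
  by rewrite lee_fin.
have g_p n : (fun x => (g_ n x)%:C) \in cLfun_pred mu p.
  apply: (cLfun_pred_le p1 _ gp).
    apply: cmeasurable_real; exact: measurable_funP.
  move=> x; rewrite !modulus_real; have /andP[h1 h2] := g_le n x.
  by rewrite !ger0_norm.
have diff n : {ae mu, forall x,
    repr (Lp_real g - Lp_real (g_ n)) x = (g x - g_ n x)%:C}.
  apply: filterS2 (reprB (Lp_real g) (Lp_real (g_ n)))
    (filterI (Lp_ofE p1 gp) (Lp_ofE p1 (g_p n))) => x -> [-> ->].
  by rewrite rmorphB.
apply: (P_closed (fun n => P_nnsfun (g_ n))); apply: Lp_dominated_cvg.
- move=> n; apply: filterS2 (diff n) (Lp_ofE p1 gp) => x xd xg.
  rewrite /modulus xd xg !normc_real; have /andP[h1 h2] := g_le n x.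
  by rewrite !ger0_norm// ?subr_ge0// gerBl.
- apply: filterS (ae_foralln diff) => x xd.
  under eq_fun do rewrite /modulus xd normc_real.
  have := cvg_nnsfun_approx measurableT mEg (fun y _ => g0 y) (Logic.I : setT x).
  move=> /fine_cvg /= gc.
  have h : (g x - g_ n x) @[n --> \oo] --> (g x - g x).
    by apply: cvgB => //; exact: cvg_cst.
  have e := cvg_norm h; rewrite subrr normr0 in e; exact: e.
Qed.

(** Positive and negative parts of the real and imaginary parts reduce the claim to [P_ge0]. All of
    them are dominated by the modulus of [u], hence p-integrable. *)
Lemma closed_indic_total u : P u.
Proof.
have [mRe mIm] := cmeasurable_repr u.
have key (g : T -> R) : measurable_fun setT g ->
    (forall x, `|g x| <= modulus (repr u) x) ->
    (fun x => (g x)%:C) \in cLfun_pred mu p /\ P (Lp_real g).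
  move=> mg gu.
  have gp (h : T -> R) : measurable_fun setT h -> (forall x, `|h x| <= `|g x|) ->
      (fun x => (h x)%:C) \in cLfun_pred mu p.
    move=> mh hg; apply: (cLfun_pred_le p1 _ (cLfunP (repr u))).
      exact: cmeasurable_real.
    by move=> x; rewrite modulus_real (le_trans (hg x)).
  have g0 := gp g mg (fun x => lexx _).
  have mpos : measurable_fun setT (fun x => Num.max (g x) 0).
    exact: measurable_maxr.
  have mneg : measurable_fun setT (fun x => Num.max (- g x) 0).
    by apply: measurable_maxr => //; exact: measurableT_comp.
  have ppos := gp _ mpos; have pneg := gp _ mneg.
  have {}ppos : (fun x => (Num.max (g x) 0)%:C) \in cLfun_pred mu p.
    apply: ppos => x; rewrite ger0_norm ?le_max ?lexx ?orbT//.
    by rewrite ge_max normr_ge0 ler_norm.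
  have {}pneg : (fun x => (Num.max (- g x) 0)%:C) \in cLfun_pred mu p.
    apply: pneg => x; rewrite ger0_norm ?le_max ?lexx ?orbT//.
    by rewrite ge_max normr_ge0 -normrN ler_norm.
  split => //.
  have -> : Lp_real g = (-1) *: Lp_real (fun x => Num.max (- g x) 0) +
      Lp_real (fun x => Num.max (g x) 0).
    apply/LpP; apply: filterS2
      (filterI (Lp_ofE p1 g0) (filterI (Lp_ofE p1 ppos) (Lp_ofE p1 pneg)))
      (filterI (reprD ((-1) *: Lp_real (fun x => Num.max (- g x) 0))
                      (Lp_real (fun x => Num.max (g x) 0)))
        (reprZ (-1) (Lp_real (fun x => Num.max (- g x) 0)))).
    move=> x [-> [ex1 ex2]] [-> ->].
    rewrite ex1 ex2 mulN1r -rmorphN -rmorphD; congr (_%:C).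
    by case: (leP (g x) 0) => gx; case: (leP (- g x) 0) => gx'; lra.
  by apply: P_linear; apply: P_ge0 => // x; rewrite le_max lexx orbT.
have [pRe PRe] := key _ mRe (Re_le_modulus _).
have [pIm PIm] := key _ mIm (Im_le_modulus _).
suff -> : u = 'i *: Lp_real (fun x => complex.Im (repr u x)) +
    Lp_real (fun x => complex.Re (repr u x)) by exact: P_linear.
apply/LpP; apply: filterS2 (filterI (Lp_ofE p1 pRe) (Lp_ofE p1 pIm))
  (filterI (reprD ('i *: Lp_real (fun x => complex.Im (repr u x)))
                  (Lp_real (fun x => complex.Re (repr u x))))
    (reprZ 'i (Lp_real (fun x => complex.Im (repr u x))))).
move=> x [ex1 ex2] [-> ->]; rewrite ex1 ex2 addrC.
exact: complexE.
Qed.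

End total.

(** * Positive operators commuting with the swaps *)

Lemma lebesgue01T (R : realType) : lebesgue01 R setT = 1%E.
Proof.
by rewrite lebesgue01E setTI lebesgue_measure_itv/= lte_fin ltr01 sube0.
Qed.

(** The null point 0 is dropped so that the half-open intervals ]0, c] and ]c, 1] cover almost
    everything. *)
Lemma ae_lebesgue01 (R : realType) : {ae lebesgue01 R, forall x, 0 < x <= 1}.
Proof.
exists [set x | ~ (0 < x <= 1)]; split => //.
  rewrite (_ : [set x | _] = ~` `]0, 1]%classic); first exact: measurableC.
  by apply/seteqP; split => x; rewrite /= in_itv.
rewrite lebesgue01E (_ : _ `&` _ = [set 0]) ?lebesgue_measure_set1//.
apply/seteqP; split => x /=; rewrite in_itv/=.
  move=> [/negP + /andP[x0 x1]]; rewrite x1 andbT -leNgt => x0'.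
  by apply/eqP; rewrite eq_le x0 x0'.
by move=> ->; rewrite ltxx lexx ler01; split.
Qed.

Lemma integral_lebesgue01_eq (R : realType) (A B : set R) (f : R -> \bar R) :
  measurable A -> measurable B -> measurable_fun setT f ->
  (forall x, 0 < x <= 1 -> A x <-> B x) ->
  (\int[lebesgue01 R]_(x in A) f x = \int[lebesgue01 R]_(x in B) f x)%E.
Proof.
move=> mA mB mf AB; rewrite integral_mkcond [RHS]integral_mkcond.
apply: ae_eq_integral => //.
- by apply/(measurable_restrictT _ _).1 => //; exact: measurable_funTS.
- by apply/(measurable_restrictT _ _).1 => //; exact: measurable_funTS.
- apply: (ae_imp (@ae_lebesgue01 R)) => x /AB ABx _; rewrite !patchE.
  by congr (if _ then _ else _); apply/idP/idP; rewrite !inE => /ABx.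
Qed.

Section commutant.
Context (R : realType) (p : R) (hp : 1 < p).
Local Notation mu := (lebesgue01 R).
Local Notation Lp := (Lp01 hp).
Local Notation ind A := (Lp_indic mu (ltW hp) A).
Variable V : operator Lp Lp.
Hypothesis V_ge0 : positive_operator V.
Hypothesis V_comm : forall S, positive_invertible_isometries mu (ltW hp) S ->
  forall u, V (S u) = S (V u).

Let p0 : 0 < p. Proof. exact: lt_trans hp. Qed.
Let muT : (mu setT < +oo)%E. Proof. by rewrite lebesgue01T ltry. Qed.

Let swap_op (a m b : R) : 0 <= a -> a < m -> m < b -> b <= 1 ->
  exists S : operator Lp Lp, positive_invertible_isometries mu (ltW hp) S /\
  forall u, {ae mu, forall x, repr (S u) x =
    (swap_weight a m b x `^ p^-1)%:C * repr u (swap a m b x)}.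
Proof.
move=> a0 am mb b1; apply: weighted_composition_ex.
- exact: measurable_swap.
- exact: measurable_swap_weight.
- by move=> x; exact: swap_weight_gt0.
- exact: swapK.
- exact: swap_weightM.
- exact: integral_swap.
Qed.

Let swap_ae (a m b : R) (P : R -> Prop) : 0 <= a -> a < m -> m < b -> b <= 1 ->
  {ae mu, forall x, P x} -> {ae mu, forall x, P (swap a m b x)}.
Proof.
move=> a0 am mb b1; apply: (@ae_comp _ _ _ mu _ (swap_weight a m b)).
- exact: measurable_swap.
- exact: measurable_swap_weight.
- by move=> x; exact: swap_weight_gt0.
- exact: integral_swap.
Qed.

Let mpow (u : Lp) : measurable_fun setT (fun x => (modulus (repr u) x `^ p)%:E).
Proof. by apply: measurable_modulus_powR; exact: cmeasurable_repr. Qed.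

(* A function vanishing on ]a, b] is fixed by the swaps inside ]a, b], hence so
   is its image g, and |g|^p has equal integrals over adjacent subintervals of
   ]a, b]. With ]a, b] cut into ]a, m], ]m, m'], ]m', b], the common integral X
   satisfies X = \int_]m, b] |g|^p = X + X. *)
Lemma commutant_local (a b : R) (u : Lp) : 0 <= a -> a < b -> b <= 1 ->
  {ae mu, forall x, a < x <= b -> repr u x = 0} ->
  {ae mu, forall x, a < x <= b -> repr (V u) x = 0}.
Proof.
move=> a0 ab b1 u0; pose g := V u.
pose I (c e : R) := (\int[mu]_(x in `]c, e]) (modulus (repr g) x `^ p)%:E)%E.
have I_eq c m e : a <= c -> c < m -> m < e -> e <= b -> I c m = I m e.
  move=> ac cm me eb.
  have c0 := le_trans a0 ac; have e1 := le_trans eb b1.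
  have [S [SU SE]] := swap_op c0 cm me e1.
  have Su : S u = u.
    have u0' : {ae mu, forall x, c < x <= e -> repr u x = 0}.
      apply: (ae_imp u0) => x ux /andP[cx xe]; apply: ux.
      by rewrite (le_lt_trans ac cx) (le_trans xe eb).
    apply/LpP; apply: (ae_imp2 (SE u) (ae_and u0' (swap_ae c0 cm me e1 u0'))).
    move=> x -> [ux usx]; have [xce|xce] := boolP (c < x <= e); last first.
      by have [-> ->] := swap_out cm me xce; rewrite powR1 mul1r.
    by rewrite ux// usx ?mulr0// swap_itv.
  have Sg : S g = g by rewrite -V_comm// Su.
  have gE : {ae mu, forall x, repr g x =
      (swap_weight c m e x `^ p^-1)%:C * repr g (swap c m e x)}.
    by have := SE g; rewrite Sg.
  rewrite /I -(integral_swapl c0 cm me e1 (mpow g)); last first.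
    by move=> x; rewrite lee_fin powR_ge0.
  apply: ae_eq_integral => //.
  - exact: measurable_funTS.
  - apply: measurable_funTS; apply: emeasurable_funM.
      by apply/measurable_EFinP; exact: measurable_swap_weight.
    by apply: measurableT_comp (mpow g) _; exact: measurable_swap.
  - apply: (ae_imp gE) => x gx _.
    have w0 := swap_weight_gt0 cm me x.
    rewrite [in LHS]/modulus gx normcM normc_real ger0_norm ?powR_ge0//.
    rewrite powRM ?powR_ge0//; last exact: (modulus_ge0 (repr g)).
    by rewrite -powRrM mulVf ?gt_eqF// powRr1// ltW.
have I_fin c e : I c e \is a fin_num.
  rewrite ge0_fin_numE; last by apply: integral_ge0 => x _; rewrite lee_fin powR_ge0.
  apply: le_lt_trans (integral_repr_lty g).
  by apply: ge0_subset_integral => // x _; rewrite lee_fin powR_ge0.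
have I_add c m e : c < m -> m < e -> I c e = (I c m + I m e)%E.
  move=> cm me; rewrite /I.
  have -> : (`]c, e] = `]c, m] `|` `]m, e] :> set R)%classic.
    by rewrite -itv_bndbnd_setU// bnd_simp ?ltW.
  rewrite ge0_integral_setU//.
  - exact: measurable_funTS.
  - by move=> x _; rewrite lee_fin powR_ge0.
  - apply/disj_setPS => x []; rewrite /= !in_itv/= => /andP[_ xm] /andP[+ _].
    by rewrite ltNge xm.
pose m := (a + b) / 2; pose m' := (m + b) / 2.
have am : a < m by rewrite /m; lra.
have mm' : m < m' by rewrite /m' /m; lra.
have m'b : m' < b by rewrite /m' /m; lra.
have mb := lt_trans mm' m'b.
have e1 : I a m = I m b by apply: I_eq.
have e2 : I a m = I m m' by apply: I_eq => //; exact: ltW.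
have e3 : I m m' = I m' b by apply: I_eq => //; exact: ltW.
have I0 : I a b = 0%E.
  move: (I_add m m' b mm' m'b) (I_add a m b am mb).
  rewrite -e3 -e2 -e1 => h ->; move: h.
  (* Finiteness excludes the solution +oo of X = X + X. *)
  move: (I a m) (I_fin a m) => [r| |]// _ [h].
  by rewrite -EFinD; congr EFin; lra.
have : (\int[mu]_(x in `]a, b]) `|(modulus (repr g) x `^ p)%:E| = 0)%E.
  by rewrite -I0; apply: eq_integral => x _; rewrite gee0_abs// lee_fin powR_ge0.
move/(ae_eq_integral_abs _ _ (measurable_funTS (mpow g))) => /(_ (measurable_itv _)).
move=> /ae_imp; apply=> x gx xab; have := gx xab => /= -[] /eqP.
by rewrite powR_eq0 => /andP[/eqP/eq0_normc].
Qed.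

Let mReV (u : Lp) : measurable_fun setT (fun x => (`|complex.Re (repr u x)|)%:E).
Proof.
apply/measurable_EFinP; apply: measurableT_comp => //.
by have [] := cmeasurable_repr u.
Qed.

Let indE (A : set R) : measurable A ->
  {ae mu, forall x, repr (ind A) x = (\1_A x)%:C}.
Proof. exact: (Lp_indicE (ltW hp) muT). Qed.

Let ind_eq (A B : set R) : measurable A -> measurable B ->
  (forall x, 0 < x <= 1 -> A x <-> B x) -> ind A = ind B.
Proof.
move=> mA mB AB; apply/LpP.
apply: (ae_imp2 (ae_and (indE mA) (indE mB)) (@ae_lebesgue01 R)).
move=> x [-> ->] /AB ABx; rewrite !indicE; congr (nat_of_bool _)%:R%:C.
by apply/idP/idP; rewrite !inE => /ABx.
Qed.

Let ind_ge0 (A : set R) : measurable A -> cLp_ge0 (ind A).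
Proof.
move=> mA; apply/Lp_ge0P; apply: (ae_imp (indE mA)) => x ->.
by rewrite indicE lecR ler0n.
Qed.

Let one : Lp := ind setT.
(** The absolute real part is nonnegative at every point of the chosen representative, as
    [integral_swapl] requires. Positivity of [V] identifies it with V 1 almost everywhere in
    [V_one]. *)
Let total : \bar R := (\int[mu]_x (`|complex.Re (repr (V one) x)|)%:E)%E.

(** Locality, applied to the indicators of ]0, c] and ]c, 1], confines each image to its own
    interval; their sum is V 1, so each image is a restriction of V 1. *)
Let V_split (c : R) : 0 < c -> c < 1 ->
  {ae mu, forall x, (0 < x <= c -> repr (V (ind `]0, c])) x = repr (V one) x) /\
                    (c < x <= 1 -> repr (V (ind `]0, c])) x = 0) /\
                    (0 < x <= c -> repr (V (ind `]c, 1])) x = 0) /\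
                    (c < x <= 1 -> repr (V (ind `]c, 1])) x = repr (V one) x)}.
Proof.
move=> c0 c1.
have oneE : one = ind `]0, c] + ind `]c, 1].
  rewrite -Lp_indicU//; last first.
    apply/seteqP; split => x //= []; rewrite !in_itv/= => /andP[_ xc] /andP[+ _].
    by rewrite ltNge xc.
  apply: ind_eq => //; first exact: measurableU.
  move=> x /andP[x0 x1]; split => // _.
  by have [xc|xc] := leP x c; [left|right]; rewrite /= in_itv/= xc ?x0.
have Vone : V one = V (ind `]0, c]) + V (ind `]c, 1]) by rewrite oneE linearD.
have v1 : {ae mu, forall x, c < x <= 1 -> repr (V (ind `]0, c])) x = 0}.
  apply: commutant_local => //; first exact: ltW.
  apply: (ae_imp (indE (measurable_itv `]0, c]))) => x -> /andP[cx _].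
  by rewrite indicE memNset//= in_itv/= leNgt cx andbF.
have v2 : {ae mu, forall x, 0 < x <= c -> repr (V (ind `]c, 1])) x = 0}.
  apply: commutant_local => //; first exact: ltW.
  apply: (ae_imp (indE (measurable_itv `]c, 1]))) => x -> /andP[_ xc].
  by rewrite indicE memNset//= in_itv/= ltNge xc.
have := reprD (V (ind `]0, c])) (V (ind `]c, 1])); rewrite -Vone => VD.
apply: (ae_imp2 VD (ae_and v1 v2)) => x Vx [v1x v2x].
split; [|split => //; split => //] => xc; rewrite Vx.
  by rewrite v2x// addr0.
by rewrite v1x// add0r.
Qed.

Let total_fin : total \is a fin_num.
Proof.
rewrite ge0_fin_numE; last exact: integral_ge0.
have /integrableP[_] := integrable_Re (@lebesgue01T R) (V one) measurableT.
by apply: le_lt_trans; apply: ge0_le_integral => //; exact: mReV.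
Qed.

Let V_one_tail (c : R) : 0 < c -> c < 1 ->
  (\int[mu]_(x in `]c, 1%R]) (`|complex.Re (repr (V one) x)|)%:E =
   (1 - c)%:E * total)%E.
Proof.
move=> c0 c1; pose N A := (\int[mu]_(x in A) (`|complex.Re (repr (V one) x)|)%:E)%E.
pose s := (1 - c) / (c - 0).
have s0 : 0 < s by rewrite /s subr0 divr_gt0// subr_gt0.
have [S [SU SE]] := swap_op (lexx 0) c0 c1 (lexx 1).
have Su2 : S (ind `]c, 1]) = (s `^ p^-1)%:C *: ind `]0, c].
  apply/LpP; apply: (ae_imp2 (ae_and (SE (ind `]c, 1])) (indE (measurable_itv `]0, c])))
    (ae_and (swap_ae (lexx 0) c0 c1 (lexx 1) (indE (measurable_itv `]c, 1])))
      (reprZ (s `^ p^-1)%:C (ind `]0, c])))).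
  move=> x [-> ix] [-> ->]; rewrite ix !indicE !mem_setE/= !in_itv/= swap_itvl//.
  have [xc|] := boolP (0 < x <= c); last by rewrite !mulr0.
  by rewrite swap_weightl.
have SV2 : S (V (ind `]c, 1])) = (s `^ p^-1)%:C *: V (ind `]0, c]).
  by rewrite -V_comm// Su2 linearZ.
have sp0 : (s `^ p^-1)%:C != 0 :> R[i].
  by rewrite (_ : 0 = 0%:C)// (inj_eq (@complexI _)) gt_eqF// powR_gt0.
(* On ]0, c] the weight is also [s], so the factor s^(1/p) cancels from both sides of [SV2]. *)
have g12 : {ae mu, forall x, 0 < x <= c ->
    repr (V (ind `]0, c])) x = repr (V (ind `]c, 1])) (swap 0 c 1 x)}.
  have := SE (V (ind `]c, 1])); rewrite SV2 => h.
  apply: (ae_imp2 h (reprZ (s `^ p^-1)%:C (V (ind `]0, c])))) => x -> e xc.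
  by move: e; rewrite (swap_weightl _ xc) => /(mulfI sp0) ->.
have split := V_split c0 c1.
have sN : (s%:E * N `]0%R, c]%classic = N `]c, 1%R]%classic)%E.
  transitivity (\int[mu]_(x in `]c, 1%R]) (`|complex.Re (repr (V (ind `]c, 1])) x)|)%:E)%E;
      last first.
    apply: ae_eq_integral => //; try by apply: measurable_funTS; exact: mReV.
    apply: (ae_imp split) => x [_ [_ [_ h]]]; rewrite /= in_itv/= => /h.
    by move=> ->.
  rewrite -(integral_swapl (lexx 0) c0 c1 (lexx 1) (mReV _))//.
  rewrite /N -ge0_integralZl_EFin//; last 2 first.
  - by apply: measurable_funTS; exact: mReV.
  - exact: ltW.
  apply: ae_eq_integral => //.
  - by apply: measurable_funeM; apply: measurable_funTS; exact: mReV.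
  - apply: measurable_funTS; apply: emeasurable_funM.
      by apply/measurable_EFinP; exact: measurable_swap_weight.
    by apply: measurableT_comp (mReV _) _; exact: measurable_swap.
  - apply: (ae_imp2 g12 split) => x gx [h _]; rewrite /= in_itv/= => xc.
    by rewrite swap_weightl// -gx// h.
have total_split : total = (N `]0%R, c]%classic + N `]c, 1%R]%classic)%E.
  rewrite /N -ge0_integral_setU//.
  - apply: integral_lebesgue01_eq => //; [exact: measurableU|exact: mReV|].
    move=> x /andP[x0 x1]; split => // _.
    by have [xc|xc] := leP x c; [left|right]; rewrite /= in_itv/= xc ?x0.
  - by apply: measurable_funTS; exact: mReV.
  - apply/disj_setPS => x []; rewrite /= !in_itv/= => /andP[_ xm] /andP[+ _].
    by rewrite ltNge xm.
have N_ge0 A : (0 <= N A)%E by exact: integral_ge0.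
(* Since [total] is finite, so is the integral r over ]0, c]. The claim becomes s r = (1 - c) (r + s
   r), which holds because 1 + s = 1 / c. *)
rewrite -/(N `]c, 1%R]%classic); move: total_split total_fin sN.
move: (N `]0%R, c]%classic) (N_ge0 `]0%R, c]%classic) => [r| |]// _; last first.
  by move=> ->; move: (N _) (N_ge0 `]c, 1%R]%classic) => [].
move=> -> _ <-; rewrite -[RHS]/(((1 - c) * (r + s * r))%:E); congr EFin.
by rewrite /s; field; exact: lt0r_neq0.
Qed.

Let lam : R := fine total.

(** The mass of [mu] is 1, so [lam] is the mean of |Re (V 1)|. By [V_one_tail] the deviation [f]
    from this mean has integral 0 over every tail, hence over every Borel set, and vanishes almost
    everywhere. *)
Let V_one : V one = lam%:C *: one.
Proof.
pose f x := `|complex.Re (repr (V one) x)| - lam.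
have iR : mu.-integrable setT (fun x => (`|complex.Re (repr (V one) x)|)%:E).
  exact/integrable_norm/(integrable_Re (@lebesgue01T R)).
have il (A : set R) : measurable A -> mu.-integrable A (fun=> lam%:E).
  move=> mA; apply/integrableP; split; first exact: measurable_cst.
    rewrite integral_cst//= lte_mul_pinfty// ?lee_fin//.
    by rewrite (le_lt_trans _ muT)// le_measure ?inE.
have iRA A : measurable A -> mu.-integrable A
    (fun x => (`|complex.Re (repr (V one) x)|)%:E).
  by move=> mA; exact: integrableS iR.
have fi : mu.-integrable setT (EFin \o f).
  exact: (integrableB measurableT iR (il _ measurableT)).
have fE A : measurable A -> (\int[mu]_(x in A) (EFin \o f) x =
    \int[mu]_(x in A) (`|complex.Re (repr (V one) x)|)%:E - lam%:E * mu A)%E.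
  move=> mA; rewrite -integral_cst// -(integralB mA (iRA _ mA) (il _ mA)).
  by apply: eq_integral => x _.
have lamE : total = lam%:E by rewrite /lam fineK.
have fT : (\int[mu]_x (EFin \o f) x = 0)%E.
  by rewrite fE// lebesgue01T mule1 -/total lamE subee.
have mf : measurable_fun setT (EFin \o f) by exact: measurable_int fi.
have f0 (A : set R) : measurable A -> (\int[mu]_(x in A) (EFin \o f) x = 0)%E.
  apply: integral_tails_eq0 => // c.
  (* A tail starting outside ]0, 1[ is everything or empty up to a null set; [V_one_tail] covers the
     other cut points. *)
  have [c0|c0] := leP c 0.
    rewrite -fT; apply: integral_lebesgue01_eq => // x /andP[x0 x1].
    by split => // _; rewrite /= in_itv/= andbT (le_lt_trans c0).
  have [c1|c1] := leP 1 c.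
    rewrite -(integral_set0 mu (EFin \o f)).
    apply: integral_lebesgue01_eq => // x /andP[x0 x1].
    by split => //; rewrite /= in_itv/= andbT ltNge (le_trans x1 c1).
  rewrite (@integral_lebesgue01_eq _ _ `]c, 1%R]%classic)//; last first.
    by move=> x /andP[x0 x1]; rewrite /= !in_itv/= andbT x1 andbT.
  rewrite fE// V_one_tail// lamE.
  have -> : mu `]c, 1]%classic = (1 - c)%:E.
    rewrite lebesgue01E setIidl; last by apply: subset_itv; rewrite bnd_simp// ltW.
    by rewrite lebesgue_measure_itv/= lte_fin c1 -EFinD.
  by rewrite muleC subee.
have fae : ae_eq mu setT (EFin \o f) (cst 0%E).
  apply: integral_ae_eq => // A _ mA; rewrite f0// integral0//.
(* Positivity makes V 1 real and nonnegative almost everywhere, so |Re (V 1)| is V 1 itself. *)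
have V1 := V_ge0 (ind_ge0 measurableT).
apply/LpP; apply: (ae_imp2 (ae_and V1 fae)
  (ae_and (reprZ lam%:C one) (indE measurableT))) => x [Vx fx] [-> ->].
have [/eqP] := fx Logic.I; rewrite indicE in_setT mulr1 -/one subr_eq0 => /eqP <-.
move: Vx; rewrite -/one; case: (repr (V one) x) => y z.
by rewrite lecE /= => /andP[/eqP -> y0]; rewrite ger0_norm.
Qed.

Let V_tail (c : R) : V (ind `]c, +oo[) = lam%:C *: ind `]c, +oo[.
Proof.
have [c0|c0] := leP c 0.
  suff -> : ind `]c, +oo[ = one by exact: V_one.
  apply: ind_eq => // x /andP[x0 x1].
  by split => // _; rewrite /= in_itv/= andbT (le_lt_trans c0).
have [c1|c1] := leP 1 c.
  have -> : ind `]c, +oo[ = ind set0.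
    apply: ind_eq => // x /andP[x0 x1].
    by split => //; rewrite /= in_itv/= andbT ltNge (le_trans x1 c1).
  have -> : ind set0 = 0.
    apply/LpP; apply: (ae_imp2 (indE measurable0) (repr0 mu (ltW hp))) => x -> ->.
    by rewrite indic0.
  by rewrite linear0 scaler0.
have -> : ind `]c, +oo[ = ind `]c, 1].
  apply: ind_eq => // x /andP[x0 x1].
  by rewrite /= !in_itv/= andbT x1 andbT.
apply/LpP.
apply: (ae_imp2 (ae_and (V_split c0 c1) (@ae_lebesgue01 R)) (ae_and
  (ae_and (reprZ lam%:C (ind `]c, 1])) (indE (measurable_itv `]c, 1])))
  (ae_and (indE measurableT) (reprZ lam%:C one)))).
rewrite -V_one => x [[_ [_ [v0 v1]]] /andP[x0 x1]] [[-> ->] [e1 e2]].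
rewrite indicE mem_setE in_itv/= x1 andbT.
have [cx|xc] := ltP c x; last by rewrite v0 ?x0// mulr0.
by rewrite v1 ?cx// e2 e1 indicE in_setT.
Qed.

Lemma commutant_scalar : exists l : R, 0 <= l /\ forall u, V u = l%:C *: u.
Proof.
exists lam; split; first by rewrite fine_ge0// integral_ge0.
have P_lin a u v : V u = lam%:C *: u -> V v = lam%:C *: v ->
    V (a *: u + v) = lam%:C *: (a *: u + v).
  by move=> Vu Vv; rewrite linearP Vu Vv scalerDr !scalerA mulrC.
have P_cl (u_ : nat -> Lp) u : (forall n, V (u_ n) = lam%:C *: u_ n) ->
    u_ n @[n --> \oo] --> u -> V u = lam%:C *: u.
  move=> Vu_ u_u.
  have h1 : V (u_ n) @[n --> \oo] --> V u.
    exact: (cvg_comp _ _ u_u (@operator_continuous _ _ _ V u)).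
  have h2 : lam%:C *: u_ n @[n --> \oo] --> lam%:C *: u by exact: cvgZr.
  apply: (cvg_unique _ h1) => //.
  by apply: cvg_trans h2; apply: near_eq_cvg; apply: nearW => n; rewrite Vu_.
apply: (closed_indic_total muT P_lin P_cl).
apply: measurable_tails_ind; [exact: V_one|exact: V_tail| |].
- move=> A mA VA.
  have -> : ind (~` A) = (-1) *: ind A + one.
    have -> : one = ind A + ind (~` A).
      by rewrite -Lp_indicU ?setUv ?setICr//; exact: measurableC.
    by rewrite scaleN1r addKr.
  by apply: P_lin => //; exact: V_one.
- move=> F mF tF VF; apply: (closed_indic_bigcup muT P_lin P_cl) => //.
  by rewrite linear0 scaler0.
Qed.

End commutant.

(** * From density to commutation *)

Section dense_commutation.
Context (K : numFieldType) (E : normedModType K).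
Variables (A D : set (operator E E)) (V : operator E E).
Hypothesis DV : forall T, D T -> limit_semigroup T V.

(** For fixed [V], phi o V is again a functional, so both sides are weakly continuous in [S]; they
    agree on [D]. *)
Lemma wot_dense_commute S (phi : operator E K^o) u :
  dense_in (A : set (wot E)) D -> A S -> phi (V (S u)) = phi (S (V u)).
Proof.
move=> AD AS; have [psi psiE] := functional_comp V phi.
rewrite -psiE; apply: (dense_in_eq (X := wot E) (f := fun S => psi (S u))
  (g := fun S => phi (S (V u))) _ _ _ AD AS).
- exact: wot_eval_continuous.
- exact: wot_eval_continuous.
- by move=> T _ /DV TV; rewrite psiE; exact: limit_semigroup_commute.
Qed.

Lemma sot_dense_commute S (phi : operator E K^o) u :
  dense_in (A : set (sot E)) D -> A S -> phi (V (S u)) = phi (S (V u)).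
Proof.
move=> AD AS; have [psi psiE] := functional_comp V phi.
have evc (chi : operator E K^o) v : continuous (fun S : sot E => (chi (S v) : K^o)).
  move=> T; apply: (@continuous_comp _ _ _ (fun S : sot E => S v) chi).
    exact: sot_eval_continuous.
  exact: operator_continuous.
rewrite -psiE; apply: (dense_in_eq (X := sot E) (f := fun S => psi (S u))
  (g := fun S => phi (S (V u))) _ _ _ AD AS); [exact: evc|exact: evc|].
by move=> T _ /DV TV; rewrite psiE; exact: limit_semigroup_commute.
Qed.

End dense_commutation.

(** * The upper bound on the scalar *)

Section scalar_limit.
Context d (T : measurableType d) (R : realType).
Variables (mu : {measure set T -> \bar R}) (p : R) (hp : 1 < p).
Hypothesis mu1 : mu setT = 1%E.
Local Notation Lp := (cLp mu (ltW hp)).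

(** The norm is not weakly continuous, so the contraction bound is carried through one functional:
    the integral of S^n 1 has real part at most the norm of S^n 1, hence at most 1. *)
Lemma limit_semigroup_scalar_le1 (S V : operator Lp Lp) (l : R) :
  (forall u, `|S u| <= `|u|) -> limit_semigroup S V ->
  (forall u, V u = l%:C *: u) -> l <= 1.
Proof.
move=> S1 [n [_ nV]] Vl.
have muT : (mu setT < +oo)%E by rewrite mu1 ltry.
pose one : Lp := Lp_indic mu (ltW hp) setT.
have oneE : {ae mu, forall x, repr one x = 1}.
  by apply: (ae_imp (Lp_indicE (ltW hp) muT measurableT)) => x ->; rewrite indicT.
have [phi phiE] := integral_on_functional hp mu1 measurableT.
have phi1 : phi one = 1.
  have key (f : T -> R) (c : R) : measurable_fun setT f ->
      {ae mu, forall x, f x = c} -> \int[mu]_x f x = c.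
    move=> mf fc; rewrite (@ae_eq_Rintegral _ _ _ mu _ _ (cst c))//.
    by rewrite Rintegral_cst// mu1 mulr1.
  have [mRe mIm] := cmeasurable_repr one.
  rewrite phiE /integral_on (key _ 1)// ?(key _ 0)//.
  - by apply: (ae_imp oneE) => x ->.
  - by apply: (ae_imp oneE) => x ->.
have norm1 : `|one| = 1.
  rewrite LpNormE (@ae_modulus_eq _ _ _ mu p _ (fun=> 1%:C)).
  - under eq_integral do rewrite modulus_real normr1 powR1.
    by rewrite integral_cst// mu1 mule1 powR1.
  - exact: cmeasurable_repr.
  - by apply: cmeasurable_real; exact: measurable_cst.
  - by apply: (ae_imp oneE) => x ->.
have Sn k : `|op_exp S k one| <= 1.
  elim: k => [|k IH]; first by rewrite -[op_exp S 0 one]/one norm1.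
  by rewrite -[op_exp S k.+1 one]/(S (op_exp S k one)) (le_trans (S1 _)).
have cv : (phi (op_exp S (n k) one) : R[i]^o) @[k --> \oo] --> (l%:C : R[i]^o).
  have := cvg_comp _ _ nV (@wot_eval_continuous _ _ one phi V).
  by rewrite Vl linearZ phi1 /= -[_ *: 1]/(_ * 1) mulr1.
rewrite leNgt; apply/negP => l1.
(* A number closer than l - 1 to [l] has real part above 1, which no iterate allows. *)
have e0 : 0 < (l - 1)%:C :> R[i] by rewrite ltcR subr_gt0.
move/cvgrPdist_lt : cv => /(_ _ e0) [N _ /(_ N (leqnn N))] /=.
set z := phi _ => zl.
have : complex.Re z <= 1.
  rewrite /z phiE; apply: le_trans (Re_integral_on_le mu1 _ measurableT) _.
  by have := Sn (n N); rewrite lecE => /andP[].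
have : l - complex.Re z < l - 1.
  rewrite -ltcR; apply: le_lt_trans zl.
  apply: le_trans (normc_ge_Re _); rewrite lecR.
  by apply: le_trans (ler_norm _); case: z => a b.
by rewrite ltrD2l ltrN2 => /lt_le_trans /[apply]; rewrite ltxx.
Qed.

End scalar_limit.

Theorem proposition3p11 (R : realType) (p : R) (hp : 1 < p)
    (V : operator (Lp01 hp) (Lp01 hp)) :
  positive_operator V ->
  let D : set (operator (Lp01 hp) (Lp01 hp)) :=
    [set T | positive_operator T /\ limit_semigroup T V] in
  [\/ dense_in (positive_contractions (lebesgue01 R) (ltW hp) : set (wot (Lp01 hp))) D,
      dense_in (positive_isometries (lebesgue01 R) (ltW hp) : set (sot (Lp01 hp))) D
    | dense_in (positive_invertible_isometries (lebesgue01 R) (ltW hp) : set (sot (Lp01 hp))) D] ->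
  exists lam : R, 0 <= lam <= 1 /\ forall u, V u = lam%:C *: u.
Proof.
move=> V0 D Ddense.
have DV T : D T -> limit_semigroup T V by case.
have mu1 := @lebesgue01T R.
(* The identity lies in all three spaces, so density is not vacuous and supplies an actual
   contraction [T] with [V] in its limit semigroup. *)
have idU : positive_invertible_isometries (lebesgue01 R) (ltW hp) (op_id _).
  by split; [split|move=> v; exists v].
have UI S : positive_invertible_isometries (lebesgue01 R) (ltW hp) S ->
  positive_isometries (lebesgue01 R) (ltW hp) S by case.
have IC S : positive_isometries (lebesgue01 R) (ltW hp) S ->
    positive_contractions (lebesgue01 R) (ltW hp) S.
  by move=> [S0 S1]; split => // u; rewrite S1.
have [T [T1 TV]] : exists T : operator (Lp01 hp) (Lp01 hp),
    (forall u, `|T u| <= `|u|) /\ limit_semigroup T V.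
  have [T [[_ T1] /DV TV]] : exists T, positive_contractions _ (ltW hp) T /\ D T.
    case: Ddense => AD.
    - by apply: dense_in_ex AD _; exact/IC/UI/idU.
    - by have [T [/IC]] := dense_in_ex AD (UI _ idU); exists T.
    - by have [T [/UI/IC]] := dense_in_ex AD idU; exists T.
  by exists T.
have V_comm S : positive_invertible_isometries (lebesgue01 R) (ltW hp) S ->
    forall u, V (S u) = S (V u).
  (* Density gives commutation only after applying a functional; integrals over measurable sets
     suffice to recover equality. *)
  move=> SU u; apply: (integral_on_inj mu1) => A mA.
  have [phi phiE] := integral_on_functional hp mu1 mA.
  rewrite -!phiE; case: Ddense => AD.
  - exact: (wot_dense_commute DV phi u AD (IC _ (UI _ SU))).
  - exact: (sot_dense_commute DV phi u AD (UI _ SU)).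
  - exact: (sot_dense_commute DV phi u AD SU).
have [lam [lam0 Vlam]] := commutant_scalar V0 V_comm.
exists lam; split=> //; rewrite lam0.
exact: (limit_semigroup_scalar_le1 mu1 T1 TV Vlam).
Qed.
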